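(* Let $F$ be a field of characteristic $2$, let $n\ge2$ be an integer, and let $\phi$ be an anisotropic quasilinear quadratic form over $F$ of dimension $2^n$. Then $\mathfrak i_1(\phi)=2^{n-2}$ if and only if $\mathrm{lndeg}(\phi)=n+1$ and $\phi$ is divisible by an $(n-2)$-fold quasi-Pfister form over $F$.
   Context: A quasilinear quadratic form over a field $K$ of characteristic 2 is a quadratic form $\phi$ on a finite-dimensional space with $\phi(v+w)=\phi(v)+\phi(w)$. $D(\phi)$ is its set of values; the norm field $N(\phi)$ is the subfield of $K$ generated over $K^2$ by all products $xy$ with $x,y\in D(\phi)$, and $\mathrm{lndeg}(\phi)=\log_2[N(\phi):K^2]$. The $m$-fold quasi-Pfister form $\langle\langle a_1,\dots,a_m\rangle\rangle$ is $\sum_{S\subseteq\{1,\dots,m\}}(\prod_{j\in S}a_j)x_S^2$ (the $0$-fold one is $\langle1\rangle$); $\phi$ is divisible by $\pi$ if $\phi\simeq\pi\otimes\sigma$ for a quasilinear $\sigma$. $\mathfrak i_0(\phi)$ is the dimension of $\{v:\phi(v)=0\}$; for anisotropic $\phi$ of dimension $\ge2$, $K(\phi)$ is the function field of the affine hypersurface $\{\phi=0\}$ and $\mathfrak i_1(\phi)=\mathfrak i_0(\phi_{K(\phi)})-\mathfrak i_0(\phi)$. *)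

(* Defs.v *)
From HB Require Import structures.
From mathcomp Require Import all_boot all_order all_algebra.
From mathcomp Require Import mpoly.
From Stdlib Require Import ClassicalDescription.

Set Implicit Arguments.
Unset Strict Implicit.
Unset Printing Implicit Defensive.

Import Order.TTheory GRing.Theory Num.Theory.
Local Open Scope ring_scope.

Definition pbool (P : Prop) : bool :=
  if excluded_middle_informative P then true else false.

(* Quasilinear quadratic forms.  A quasilinear form on a space with    *)
(* basis indexed by the finite type I is a diagonal form               *)
(*   <a_i>_i : v |-> \sum_i a_i v_i^2                                  *)
(* (every quasilinear form is isometric to such a diagonal form).      *)
Definition qf (K : fieldType) (I : finType) (a : I -> K) (v : I -> K) : K :=
  \sum_(i : I) a i * (v i) ^+ 2.

Definition anisotropic (K : fieldType) (I : finType) (a : I -> K) : Prop :=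
  forall v : I -> K, qf a v = 0 -> forall i, v i = 0.

Definition isometric (K : fieldType) (I J : finType) (a : I -> K) (b : J -> K)
  : Prop :=
  exists (M : J -> I -> K) (N : I -> J -> K),
    (forall i i', \sum_(j : J) N i j * M j i' = (i == i')%:R) /\
    (forall j j', \sum_(i : I) M j i * N i j' = (j == j')%:R) /\
    (forall v : I -> K, qf b (fun j => \sum_(i : I) M j i * v i) = qf a v).

Definition qpfister (K : fieldType) (m : nat) (b : 'I_m -> K)
  : {set 'I_m} -> K :=
  fun S => \prod_(j in S) b j.

Definition qtensor (K : fieldType) (I J : finType) (a : I -> K) (b : J -> K)
  : (I * J)%type -> K :=
  fun p => a p.1 * b p.2.

Definition divisible_by_qpfister (K : fieldType) (I : finType) (a : I -> K)
  (m : nat) : Prop :=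
  exists (b : 'I_m -> K) (e : nat) (sigma : 'I_e -> K),
    isometric a (qtensor (qpfister b) sigma).

Definition values (K : fieldType) (I : finType) (a : I -> K) (z : K) : Prop :=
  exists v : I -> K, z = qf a v.

Definition squares (K : fieldType) (z : K) : Prop := exists y : K, z = y ^+ 2.

Definition is_subfield (K : fieldType) (S : K -> Prop) : Prop :=
  [/\ S 0, S 1,
      (forall x y, S x -> S y -> S (x - y)),
      (forall x y, S x -> S y -> S (x * y)) &
      (forall x, S x -> S x^-1)].

Definition norm_field (K : fieldType) (I : finType) (a : I -> K) (z : K)
  : Prop :=
  forall S : K -> Prop, is_subfield S ->
    (forall y, squares y -> S y) ->
    (forall x y, values a x -> values a y -> S (x * y)) ->
    S z.

Definition ext_degree_eq (K : fieldType) (K0 L : K -> Prop) (k : nat) : Prop :=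
  exists e : 'I_k -> K,
    (forall i, L (e i)) /\
    (forall c : 'I_k -> K, (forall i, K0 (c i)) ->
        \sum_(i < k) c i * e i = 0 -> forall i, c i = 0) /\
    (forall z, L z -> exists c : 'I_k -> K,
        (forall i, K0 (c i)) /\ z = \sum_(i < k) c i * e i).

Definition lndeg_eq (K : fieldType) (I : finType) (a : I -> K) (k : nat)
  : Prop :=
  ext_degree_eq (@squares K) (norm_field a) (2 ^ k).

(* Isotropy index i_0: dimension of the K-subspace {v | phi(v) = 0},   *)
(* i.e. the maximal number of K-linearly independent zeros of phi.     *)
Definition lin_indep (K : fieldType) (I : finType) (m : nat)
  (v : 'I_m -> I -> K) : Prop :=
  forall c : 'I_m -> K,
    (forall i : I, \sum_(j < m) c j * v j i = 0) -> forall j, c j = 0.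

Definition has_indep_zeros (K : fieldType) (I : finType) (a : I -> K) (m : nat)
  : Prop :=
  exists v : 'I_m -> I -> K, (forall j, qf a (v j) = 0) /\ lin_indep v.

Definition i0 (K : fieldType) (I : finType) (a : I -> K) : nat :=
  \max_(m < #|I|.+1 | pbool (has_indep_zeros a m)) m.

(* Function field F(phi) of the affine hypersurface {phi = 0}, for     *)
(* phi = <a_1..a_d> over F: a field extension iota : F -> K with a     *)
(* point x in K^d such that the evaluation F[X_1..X_d] -> K, X_i |-> x_i *)
(* has kernel exactly (phi(X)) and K is generated by x over F, i.e.    *)
(* K ~= Frac(F[X]/(phi)).                                              *)
Definition qf_poly (F : fieldType) (d : nat) (a : 'I_d -> F) : {mpoly F[d]} :=
  \sum_(i < d) a i *: 'X_i ^+ 2.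

Definition is_function_field (F : fieldType) (d : nat) (a : 'I_d -> F)
  (K : fieldType) (iota : {rmorphism F -> K}) (x : 'I_d -> K) : Prop :=
  [/\ mmap iota x (qf_poly a) = 0,
      (forall p : {mpoly F[d]}, mmap iota x p = 0 ->
          exists q : {mpoly F[d]}, p = q * qf_poly a) &
      (forall z : K, exists p q : {mpoly F[d]},
          mmap iota x q != 0 /\ z = mmap iota x p / mmap iota x q)].

Definition i1_eq (F : fieldType) (d : nat) (a : 'I_d -> F) (k : nat) : Prop :=
  forall (K : fieldType) (iota : {rmorphism F -> K}) (x : 'I_d -> K),
    is_function_field a iota x ->
    (i0 (fun i => iota (a i)) - i0 a)%N = k.

(* Main.v *)
Require Import Defs.
From HB Require Import structures.
From mathcomp Require Import all_boot all_order all_algebra all_field.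
From mathcomp Require Import mpoly ring.
From Stdlib Require ClassicalDescription ClassicalEpsilon.
Set Implicit Arguments.
Unset Strict Implicit.
Unset Printing Implicit Defensive.
Import GRing.Theory.
Local Open Scope ring_scope.

(** Scale [a] so that the set of values [V] contains 1, and view [V] inside a
    finite extension [L] of [F ^ 2].  Writing [F(phi) = R(sqrt b)] with [b] a
    generic element of [V], the zeros of [phi] over [F(phi)] form a space of
    [R]-dimension [dim {w in V | w b in V}]; since [F] is infinite, [2 i_1] is
    therefore the minimum over [b] in [V] of the dimension of
    [W_b = {w in V | w b in V}].

    Let [m = 2 ^ (n - 2)], so [dim V = 4m]; suppose that this minimum is [2m]
    and call [b] good if it is attained at [b].  A pencil of matrices whose
    rank is maximal at [X] maps [ker X] into the image of [X]; hence
    [W_b V] lies in [U = V + V b].  So [U],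
    of dimension [6m], is a module over the field generated by [W_b]; this
    field has [2]-power degree, so it is [W_b] itself.  For two good elements
    [b, c] in general position the field [Q = W_b :&: W_c] has degree [m], and
    the same rank argument for the pair [(b, c)] shows [Q V = V].  Then
    [V = Q + Q b + Q c + Q e] and the norm field [Q(b, c, e)] has degree [8m].

    Conversely, if [V] is a module over a field [S] of degree [m] and [b] is in
    [V] but not in [S], then [S(b)] lies in [W_b], and an element [u] of [W_b]
    outside [S(b)] would force [V] to be the field [S(b, u)]. *)

(** * Pencils of matrices *)

(** A nonvanishing minor turns a lower bound on the rank into a polynomial condition, which persists
    at a generic parameter. *)
Lemma max_minor_neq0 (F : fieldType) m n (A : 'M[F]_(m, n)) :
  exists (f : 'I_(\rank A) -> 'I_m) (g : 'I_(\rank A) -> 'I_n),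
    \det (mxsub f g A) != 0.
Proof.
pose B := rowsub (maxrankfun A) A.
have fullB : row_full B^T.
  by rewrite /row_full mxrank_tr; apply: maxrowsub_free.
exists (maxrankfun A), (fullrankfun fullB).
rewrite -det_tr -unitfE -unitmxE.
suff -> : (mxsub (maxrankfun A) (fullrankfun fullB) A)^T
          = rowsub (fullrankfun fullB) B^T by exact: fullrowsub_unit.
by apply/matrixP=> i j; rewrite !mxE.
Qed.

Lemma minor_leq_rank (F : fieldType) m n r (A : 'M[F]_(m, n))
    (f : 'I_r -> 'I_m) (g : 'I_r -> 'I_n) :
  \det (mxsub f g A) != 0 -> (r <= \rank A)%N.
Proof.
move=> nz_det.
have /eqP <- : row_free (mxsub f g A) by rewrite row_free_unit unitmxE unitfE.
have -> : mxsub f g A = rowsub f 1%:M *m A *m colsub g 1%:M.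
  by rewrite mul_rowsub_mx mul1mx mulmx_colsub mulmx1 -mxsubcr.
exact: leq_trans (mxrankM_maxl _ _) (mxrankM_maxr _ _).
Qed.

Section Pencils.
Variables (F : fieldType) (m n : nat).
Implicit Types X Y : 'M[F]_(m, n).

(** Lower semicontinuity of the rank: along the line, a nonzero maximal minor of [X] becomes a
    polynomial in [s] that does not vanish at [0]. *)
Lemma pencil_rank_generic X Y : exists2 p : {poly F}, p.[0] != 0 &
  forall s, p.[s] != 0 -> (\rank X <= \rank (X + s *: Y)%R)%N.
Proof.
have [f [g nz]] := max_minor_neq0 X.
pose Z : 'M[{poly F}]_(m, n) := map_mx polyC X + 'X *: map_mx polyC Y.
have evZ s : (\det (mxsub f g Z)).[s] = \det (mxsub f g (X + s *: Y)).
  rewrite -[LHS]/(horner_eval s _) -det_map_mx map_mxsub; congr (\det (mxsub _ _ _)).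
  by apply/matrixP=> i j; rewrite !mxE /= /horner_eval !hornerE.
exists (\det (mxsub f g Z)); first by rewrite evZ scale0r addr0.
by move=> s; rewrite evZ; apply: minor_leq_rank.
Qed.

Hypothesis Finf : forall p : {poly F}, p != 0 -> exists s, p.[s] != 0.

(* If [w Y] were not in the row space of [X], stacking it below [X + s Y] would
   raise the rank for some [s != 0], although [w Y = s^-1 w (X + s Y)]. *)
Lemma pencil_kernel X Y (p : {poly F}) (w : 'rV_m) : p != 0 ->
    (forall s, p.[s] != 0 -> (\rank (X + s *: Y)%R <= \rank X)%N) ->
  w *m X = 0 -> (w *m Y <= X)%MS.
Proof.
move=> nz_p le_p wX0; apply: contraT => wYX.
have lt_rk : (\rank X < \rank (col_mx X (w *m Y)))%N.
  have : (X < col_mx X (w *m Y))%MS.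
    rewrite ltmxE -addsmxE addsmxSl /=; apply: contra wYX.
    by apply: submx_trans; rewrite -addsmxE addsmxSr.
  by rewrite ltmxErank => /andP[].
have [q q0 qP] : exists2 q : {poly F}, q.[0] != 0 & forall s, q.[s] != 0 ->
    (\rank (col_mx X (w *m Y)) <= \rank (col_mx (X + s *: Y)%R (w *m Y)))%N.
  have [f [g nz]] := max_minor_neq0 (col_mx X (w *m Y)).
  pose Z := col_mx (map_mx polyC X + 'X *: map_mx polyC Y) (map_mx polyC (w *m Y)).
  have evZ s : (\det (mxsub f g Z)).[s]
               = \det (mxsub f g (col_mx (X + s *: Y) (w *m Y))).
    rewrite -[LHS]/(horner_eval s _) -det_map_mx map_mxsub map_col_mx.
    congr (\det (mxsub _ _ (col_mx _ _))).
      by apply/matrixP=> i j; rewrite !mxE /= /horner_eval !hornerE.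
    by apply/matrixP=> i j; rewrite !mxE /= /horner_eval hornerC.
  exists (\det (mxsub f g Z)); first by rewrite evZ scale0r addr0.
  by move=> s; rewrite evZ; apply: minor_leq_rank.
have nz_q : q != 0 by apply: contraNneq q0 => ->; rewrite horner0.
have [s] : exists s, (p * q * 'X).[s] != 0.
  by apply: Finf; rewrite !mulf_neq0 ?polyX_eq0.
rewrite !hornerM hornerX !mulf_eq0 !negb_or -andbA => /and3P[ps qs s0].
suff sub : (col_mx (X + s *: Y)%R (w *m Y) <= (X + s *: Y)%R)%MS.
  have := leq_trans (qP s qs) (mxrankS sub).
  by move/(leq_trans lt_rk)/leq_trans/(_ (le_p s ps)); rewrite ltnn.
rewrite -addsmxE addsmx_sub submx_refl /=.
have -> : w *m Y = (s^-1 *: w) *m (X + s *: Y).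
  by rewrite mulmxDr -!scalemxAl wX0 scaler0 add0r -scalemxAr scalerA mulVf // scale1r.
exact: submxMl.
Qed.

End Pencils.

(** * The spaces [W_b] *)

Section SpanMatrices.
Import VectorInternalTheory.
Variables (F : fieldType) (vT : vectType F) (d : nat).
Implicit Types (vt : d.-tuple vT) (c : 'rV[F]_d).

Lemma sum_b2mx vt c : \sum_(i < d) c 0 i *: vt`_i = r2v (c *m b2mx vt).
Proof.
rewrite mulmx_sum_row linear_sum; apply: eq_bigr => i _.
by rewrite linearZ /= b2mxK.
Qed.

Lemma mem_mx2vs m (A : 'M[F]_(m, dim vT)) (x : vT) :
  (x \in mx2vs A) = (v2r x <= A)%MS.
Proof. by rewrite -[x \in _]/(vs2mx (vline x) <= _)%MS /= !genmxE. Qed.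

Lemma free_b2mx vt : free vt = row_free (b2mx vt).
Proof.
have span_vt : <<vt>>%VS = mx2vs (b2mx vt).
  by rewrite unlock tvalK; case: _ / (esym _).
by rewrite /free /dimv span_vt /= genmxE size_tuple.
Qed.

(** In coordinates on [vt], [W] is the left kernel of [T], and the formula is rank-nullity. *)
Lemma dim_solution_space q (V W : {vspace vT}) vt (T : 'M[F]_(d, q)) :
    basis_of V vt -> (W <= V)%VS ->
    (forall c, (\sum_(i < d) c 0 i *: vt`_i \in W) = (c *m T == 0)) ->
  (\dim W + \rank T = d)%N.
Proof.
move=> bV sWV memW.
suff -> : W = mx2vs (kermx T *m b2mx vt).
  rewrite /dimv /= genmxE mxrankMfree -?free_b2mx ?(basis_free bV) //.
  by rewrite mxrank_ker subnK ?rank_leq_row.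
apply/vspaceP=> x; rewrite mem_mx2vs; apply/idP/idP=> [Wx | /submxP[u def_x]].
  have /coord_basis def_x := subvP sWV x Wx.
  pose c := \row_i coord vt i x.
  have {}def_x : x = \sum_(i < d) c 0 i *: vt`_i.
    by rewrite {1}(def_x _ _ bV); apply: eq_bigr => i _; rewrite mxE.
  move: Wx; rewrite {1}def_x memW => cT0.
  by rewrite def_x sum_b2mx r2vK submxMr //; apply/sub_kermxP/eqP.
rewrite -[x]v2rK def_x mulmxA -sum_b2mx memW -mulmxA mulmx_ker mulmx0.
exact: eqxx.
Qed.

End SpanMatrices.

Section Multipliers.
Import VectorInternalTheory.
Variables (F : fieldType) (L : fieldExtType F) (V : {vspace L}).
Implicit Types (b c e w x y : L).

Definition idealizer b : {vspace L} := (V :&: amulr b @^-1: V)%VS.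

Lemma mem_idealizer b w : (w \in idealizer b) = (w \in V) && (w * b \in V).
Proof. by rewrite memv_cap -memv_preim lfunE. Qed.

Lemma idealizer_sub b : (idealizer b <= V)%VS.
Proof. exact: capvSl. Qed.

(** An endomorphism of [L] with kernel exactly [V]; it stands in for the quotient map to [L / V]. *)
Definition off x := x - projv V x.

Fact off_is_linear : linear off.
Proof. by move=> a x y; rewrite /off linearP /= scalerBr opprD addrACA. Qed.
HB.instance Definition _ := GRing.isLinear.Build F L L *:%R off off_is_linear.

Lemma off_eq0 x : (off x == 0) = (x \in V).
Proof.
rewrite subr_eq0; apply/eqP/idP => [-> | /projv_id->] //; exact: memv_proj.
Qed.

Lemma v2r_off_eq0 x : (v2r (off x) == 0) = (x \in V).
Proof. by rewrite -off_eq0 -(inj_eq (@v2r_inj _ L)) linear0. Qed.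

(* Since [off] vanishes exactly on [V], this represents [w |-> w * b] modulo
   [V], for [w] given by its coordinates in the basis [vt] of [V]. *)
Definition offmx d (vt : d.-tuple L) b : 'M[F]_(d, dim L) :=
  \matrix_i v2r (off (vt`_i * b)).

Lemma mul_offmx d (vt : d.-tuple L) b (c : 'rV_d) :
  c *m offmx vt b = v2r (off ((\sum_(i < d) c 0 i *: vt`_i) * b)).
Proof.
rewrite mulr_suml !linear_sum mulmx_sum_row; apply: eq_bigr => i _.
by rewrite rowK -scalerAl !linearZ.
Qed.

Lemma offmxD d (vt : d.-tuple L) s b c :
  offmx vt (b + s *: c) = offmx vt b + s *: offmx vt c.
Proof.
apply/matrixP=> i j; rewrite !mxE.
have -> : off (vt`_i * (b + s *: c)) = off (vt`_i * b) + s *: off (vt`_i * c).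
  by rewrite mulrDr -scalerAr addrC linearP addrC.
by rewrite [_ + s *: _]addrC linearP !mxE addrC.
Qed.

Lemma offmx_sum d (vt : d.-tuple L) (I : finType) (s : I -> F) (b : I -> L) :
  offmx vt (\sum_i s i *: b i) = \sum_i s i *: offmx vt (b i).
Proof.
apply/matrixP=> i j; rewrite summxE !mxE mulr_sumr !linear_sum summxE.
by apply: eq_bigr => k _; rewrite -scalerAr !linearZ /= !mxE.
Qed.

Lemma dim_idealizer d (vt : d.-tuple L) b :
  basis_of V vt -> (\dim (idealizer b) + \rank (offmx vt b) = d)%N.
Proof.
move=> bV; apply: dim_solution_space (bV) (idealizer_sub b) _ => c.
rewrite mem_idealizer mul_offmx v2r_off_eq0.
rewrite andb_idl // => _; apply: memv_suml => i _.
by apply/memvZ/(basis_mem bV); rewrite mem_nth ?size_tuple.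
Qed.

Let d := \dim V.
Let vt : d.-tuple L := vbasis V.
Let pairmx b c := row_mx (offmx vt b) (offmx vt c).

Let pairmxD s b b' c c' :
  pairmx (b + s *: b') (c + s *: c') = pairmx b c + s *: pairmx b' c'.
Proof. by rewrite /pairmx !offmxD scale_row_mx add_row_mx. Qed.

Let dim_pair b c :
  (\dim (idealizer b :&: idealizer c) + \rank (pairmx b c) = d)%N.
Proof.
apply: dim_solution_space (vbasisP V) _ _ => [|r].
  exact: subv_trans (capvSl _ _) (idealizer_sub b).
rewrite memv_cap !mem_idealizer mul_mx_row !mul_offmx.
have -> : \sum_(i < d) r 0 i *: vt`_i \in V.
  by apply: memv_suml => i _; apply/memvZ/vbasis_mem/mem_nth; rewrite size_tuple.
by rewrite row_mx_eq0 !v2r_off_eq0.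
Qed.

(** The intersection of two idealizers is the left kernel of [pairmx b c], and [pairmx] is affine
    along lines. Semicontinuity of the rank therefore bounds the dimension from above. *)
Lemma dim_idealizer2_generic b b' c c' : exists2 p : {poly F}, p.[0] != 0 &
  forall s, p.[s] != 0 ->
    (\dim (idealizer (b + s *: b') :&: idealizer (c + s *: c'))
       <= \dim (idealizer b :&: idealizer c))%N.
Proof.
have [p p0 pP] := pencil_rank_generic (pairmx b c) (pairmx b' c').
exists p => // s /pP; rewrite -pairmxD => le_rk.
rewrite -(leq_add2r (\rank (pairmx b c))) dim_pair.
by rewrite -[leqRHS](dim_pair (b + s *: b') (c + s *: c')) leq_add2l.
Qed.

Lemma dim_idealizer_generic b b' : exists2 p : {poly F}, p.[0] != 0 &
  forall s, p.[s] != 0 ->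
    (\dim (idealizer (b + s *: b')) <= \dim (idealizer b))%N.
Proof.
have [p p0 pP] := dim_idealizer2_generic b b' b b'.
by exists p => // s /pP; rewrite !capvv.
Qed.

Hypothesis Finf : forall p : {poly F}, p != 0 -> exists s, p.[s] != 0.

(** The hypothesis makes the rank of [pairmx] generically maximal at [(b, c)], so [pencil_kernel]
    applies to the coordinates of [w]. The two blocks share one row vector, hence a single [u]
    serves both. *)
Lemma idealizer2_pencil b b' c c' (p : {poly F}) w : p != 0 ->
    (forall s, p.[s] != 0 -> (\dim (idealizer b :&: idealizer c) <=
      \dim (idealizer (b + s *: b') :&: idealizer (c + s *: c')))%N) ->
    w \in (idealizer b :&: idealizer c)%VS ->
  exists u, [/\ u \in V, w * b' - u * b \in V & w * c' - u * c \in V].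
Proof.
move=> nz_p le_dim; rewrite memv_cap !mem_idealizer -andbA.
case/and4P=> Vw Vwb _ Vwc.
pose r := \row_i coord vt i w.
have def_w : w = \sum_(i < d) r 0 i *: vt`_i.
  by rewrite {1}(coord_vbasis Vw); apply: eq_bigr => i _; rewrite mxE.
have r0 : r *m pairmx b c = 0.
  rewrite mul_mx_row !mul_offmx -def_w.
  by apply/eqP; rewrite row_mx_eq0 !v2r_off_eq0 Vwb.
have le_rk s : p.[s] != 0 ->
    (\rank (pairmx b c + s *: pairmx b' c')%R <= \rank (pairmx b c))%N.
  move=> /le_dim; rewrite -pairmxD => le_dim_s.
  rewrite -(leq_add2l (\dim (idealizer b :&: idealizer c))) dim_pair.
  by rewrite -[leqRHS](dim_pair (b + s *: b') (c + s *: c')) leq_add2r.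
have /submxP[u] := pencil_kernel Finf nz_p le_rk r0.
rewrite !mul_mx_row !mul_offmx -def_w => /eq_row_mx[/v2r_inj eqb /v2r_inj eqc].
exists (\sum_(i < d) u 0 i *: vt`_i); split.
- by apply: memv_suml => i _; apply/memvZ/vbasis_mem/mem_nth; rewrite size_tuple.
- by rewrite -off_eq0 linearB /= eqb subrr.
by rewrite -off_eq0 linearB /= eqc subrr.
Qed.

Lemma idealizer_pencil b b' (p : {poly F}) w : p != 0 ->
    (forall s, p.[s] != 0 ->
      (\dim (idealizer b) <= \dim (idealizer (b + s *: b')))%N) ->
    w \in idealizer b ->
  exists2 u, u \in V & w * b' - u * b \in V.
Proof.
move=> nz_p le_dim Ww.
have [s ps||u [Vu Vub _]] := @idealizer2_pencil b b' b b' p w nz_p.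
- by move: (le_dim s ps); rewrite !capvv.
- by rewrite capvv.
by exists u.
Qed.

End Multipliers.

(** * Spaces whose least idealizer has half dimension *)

Section SquareRoots.
Variables (F : fieldType) (L : fieldExtType F).
Hypothesis sqr1 : forall y : L, y ^+ 2 \in 1%VS.
Implicit Types (K E : {subfield L}) (x y : L).

(** As [x ^ 2] is a scalar, the minimal polynomial of [x] divides [X ^ 2 - x ^ 2], so polynomials in
    [x] reduce to degree at most 1. *)
Lemma Fadjoin_sqrP K x y :
  y \in <<K; x>>%VS -> exists2 p, p \in K & exists2 q, q \in K & y = p + q * x.
Proof.
move=> Kxy; have [Kx | K'x] := boolP (x \in K).
  exists y; last by exists 0; rewrite ?mem0v // mul0r addr0.
  by rewrite -(Fadjoin_idP Kx).
have szM : (size (minPoly K x) <= 3)%N.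
  have -> : 3%N = size ('X^2 - (x ^+ 2)%:P : {poly L}) by rewrite size_XnsubC.
  apply: dvdp_leq; first by rewrite -size_poly_eq0 size_XnsubC.
  apply: minPoly_dvdp; last by rewrite rootE !hornerE subrr.
  rewrite rpredB ?polyOverXn // polyOverC.
  by rewrite (subvP (sub1v K)) ?sqr1.
have := Fadjoin_poly_eq Kxy; have := size_Fadjoin_poly K x y.
have := Fadjoin_polyOver K x y; move: (Fadjoin_poly K x y) => r /polyOverP Kr.
rewrite size_minPoly ltnS in szM; move=> /leq_trans/(_ szM) szr <-.
exists r`_0 => //; exists r`_1 => //.
by rewrite (horner_coef_wide _ szr) big_ord_recl big_ord1 /= expr0 mulr1 expr1.
Qed.

Lemma Fadjoin_sqrE K x : <<K; x>>%VS = (K + K * <[x]>)%VS.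
Proof.
apply/eqP; rewrite eqEsubv subv_add subv_adjoin /= andbC; apply/andP; split.
  apply/prodvP=> p _ Kp /vlineP[a ->]; rewrite memvM ?memvZ ?memv_adjoin //.
  exact: subvP_adjoin.
apply/subvP=> y /Fadjoin_sqrP[p Kp [q Kq ->]].
by rewrite memv_add // memv_mul ?memv_line.
Qed.

(** A nonzero [q * x] in the intersection would bring [x = q^-1 * (q * x)] into the [K]-module
    [X]. *)
Lemma cap_coset_eq0 K (X : {vspace L}) x :
  (K * X <= X)%VS -> x \notin X -> (X :&: K * <[x]> = 0)%VS.
Proof.
move=> sKX X'x; apply/eqP; rewrite -subv0; apply/subvP=> y.
rewrite memv_cap => /andP[Xy /memv_cosetP[q Kq def_y]].
have [q0 | nz_q] := eqVneq q 0; first by rewrite def_y q0 mul0r mem0v.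
case/negP: X'x; have -> : x = q^-1 * y by rewrite def_y mulKf.
by apply: (subvP sKX); rewrite memv_mul ?memvV.
Qed.

Lemma dim_Fadjoin_sqr K x : x \notin K -> \dim <<K; x>> = (2 * \dim K)%N.
Proof.
move=> K'x; rewrite Fadjoin_sqrE dimv_disjoint_sum ?cap_coset_eq0 ?asubv //.
rewrite dim_cosetv ?mul2n ?addnn //.
by apply: contraNneq K'x => ->; rewrite mem0v.
Qed.

(** Climb from [K] to [E] one generator at a time; each new generator doubles the dimension. *)
Lemma dim_subfield_pow2 K E :
  (K <= E)%VS -> exists t, \dim E = (2 ^ t * \dim K)%N.
Proof.
have [n] := ubnP (\dim E - \dim K); elim: n K => // n IHn K le_n sKE.
have [sEK | /subvPn[x Ex K'x]] := boolP (E <= K)%VS.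
  by exists 0%N; rewrite mul1n; apply/eqP; rewrite eqn_leq !dimvS.
have sKxE : (<<K; x>> <= E)%VS by apply/FadjoinP.
have dimKx := dim_Fadjoin_sqr K'x.
have [|t dimE] := IHn [aspace of <<K; x>>%VS] _ sKxE.
  rewrite /= dimKx; have := dimvS sKxE; rewrite dimKx => leE.
  move: le_n; rewrite ltnS => /(leq_trans _); apply.
  apply: ltn_sub2l; last by rewrite mul2n -addnn -[ltnLHS]addn0 ltn_add2l adim_gt0.
  by apply: leq_trans leE; rewrite mul2n -addnn -[ltnLHS]addn0 ltn_add2l adim_gt0.
by exists t.+1; rewrite dimE /= dimKx expnSr -mulnA.
Qed.

Lemma dim_subfield_expn2 E : exists t, \dim E = (2 ^ t)%N.
Proof.
have [t] := dim_subfield_pow2 (sub1v E).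
by rewrite dimv1 muln1; exists t.
Qed.

End SquareRoots.

(** * Structure of [V] when the least idealizer has half dimension *)

Section HalfIdealizers.
Variables (F : fieldType) (L : fieldExtType F).
Hypothesis sqr1 : forall y : L, y ^+ 2 \in 1%VS.
Hypothesis Finf : forall p : {poly F}, p != 0 -> exists s, p.[s] != 0.
Variables (V : {vspace L}) (s : nat).
Hypotheses (V1 : 1 \in V) (dimV : \dim V = (4 * 2 ^ s)%N).
Hypothesis min_dim : forall b, b \in V -> (2 * 2 ^ s <= \dim (idealizer V b))%N.
Implicit Types b c e w x y : L.

Let m := (2 ^ s)%N.
Let m_gt0 : (0 < m)%N. Proof. by rewrite expn_gt0. Qed.

Definition good b := (b \in V) && (\dim (idealizer V b) == 2 * m)%N.

Let V_sqrl y w : w \in V -> y ^+ 2 * w \in V.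
Proof. by move=> Vw; have /vlineP[a ->] := sqr1 y; rewrite -scalerAl mul1r memvZ. Qed.

(** Goodness is an open condition: semicontinuity gives the upper bound on the dimension and
    [min_dim] the lower one. *)
Lemma good_line b e : good b -> e \in V ->
  exists2 p : {poly F}, p.[0] != 0 & forall t, p.[t] != 0 -> good (b + t *: e).
Proof.
move=> /andP[Vb /eqP dimb] Ve; have [p p0 pP] := dim_idealizer_generic V b e.
exists p => // t /pP; rewrite dimb => le_dim.
have Vbe : b + t *: e \in V by rewrite memvD ?memvZ.
by rewrite /good Vbe eqn_leq le_dim min_dim.
Qed.

(** The idealizers have generically constant dimension on the line [b + t c], so the pencil lemma
    applies. The outcome says that [W_b V] lies in [V + V b]. *)
Lemma good_mul b w c : good b -> w \in idealizer V b -> c \in V ->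
  exists2 u, u \in V & w * c - u * b \in V.
Proof.
move=> gb Ww Vc; have [p p0 pP] := good_line gb Vc.
apply: (idealizer_pencil Finf (p := p)) (Ww) => [|t /pP /andP[_ /eqP->]].
  by apply: contraNneq p0 => ->; rewrite horner0.
by case/andP: gb => _ /eqP->.
Qed.

(** Avoiding a subspace is an open condition: some coordinate of [off X x] is nonzero, and it varies
    along the line as a polynomial in [t]. *)
Lemma line_off (X : {vspace L}) x y : x \notin X ->
  exists2 p : {poly F}, p.[0] != 0 & forall t, p.[t] != 0 -> x + t *: y \notin X.
Proof.
rewrite -off_eq0 => nz_x.
have [i nz_i] : exists i, coord (vbasis {:L}) i (off X x) != 0.
  apply/existsP; apply: contraR nz_x => /existsPn z_x; apply/eqP.
  rewrite (coord_vbasis (memvf (off X x))) big1 // => i _.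
  by rewrite (eqP (negbNE (z_x i))) scale0r.
exists ((coord (vbasis {:L}) i (off X x))%:P + 'X * (coord (vbasis {:L}) i (off X y))%:P).
  by rewrite !hornerE.
move=> t; rewrite !hornerE => nz_t; rewrite -off_eq0.
apply: contraNneq nz_t => xy0.
have : coord (vbasis {:L}) i (off X (t *: y + x)) = 0 by rewrite addrC xy0 linear0.
by rewrite !linearP /= addrC => ->.
Qed.

(** If [b] lies in [X], a generic nonzero displacement towards some [e] of [V] outside [X] leaves
    [X] and keeps [b] good. *)
Lemma good_avoid (X : {vspace L}) b : good b -> ~~ (V <= X)%VS ->
  exists2 e, good e & e \notin X.
Proof.
move=> gb /subvPn[e Ve X'e]; have [Xb | X'b] := boolP (b \in X); last by exists b.
have [p p0 pP] := good_line gb Ve.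
have [|t] := Finf (p := p * 'X).
  by rewrite mulf_neq0 ?polyX_eq0 //; apply: contraNneq p0 => ->; rewrite horner0.
rewrite hornerM hornerX mulf_eq0 negb_or => /andP[/pP gt t0].
exists (b + t *: e) => //; apply: contra X'e => Xbe.
have -> : e = t^-1 *: ((b + t *: e) - b) by rewrite addrC addKr scalerA mulVf ?scale1r.
by rewrite memvZ // memvB.
Qed.

Lemma good_neq0 b : good b -> b != 0.
Proof.
move=> /andP[_ /eqP dimb]; apply/eqP => b0.
have : (V <= idealizer V b)%VS.
  by apply/subvP=> w Vw; rewrite mem_idealizer Vw b0 mulr0 mem0v.
move/dimvS; rewrite dimb dimV leq_pmul2r //.
Qed.

(** The intersection of [V] and [V b] is [W_b b], so the dimension is [4m + 4m - 2m]. *)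
Lemma good_extension_dim b : good b -> \dim (V + V * <[b]>) = (6 * m)%N.
Proof.
move=> gb; have nz_b := good_neq0 gb.
have capE : (V :&: V * <[b]> = idealizer V b * <[b]>)%VS.
  apply/vspaceP=> x; rewrite memv_cap; apply/andP/memv_cosetP.
    move=> [Vx /memv_cosetP[w Vw def_x]].
    by exists w => //; rewrite mem_idealizer Vw -def_x.
  move=> [w]; rewrite mem_idealizer => /andP[Vw Vwb] ->.
  by rewrite Vwb memv_mul ?memv_line.
apply/eqP; rewrite -(eqn_add2r (\dim (V :&: V * <[b]>))) dimv_sum_cap capE.
rewrite !dim_cosetv // dimV; case/andP: gb => _ /eqP->.
by rewrite -!mulnDl.
Qed.

(** By [good_mul], [w e] is [v b] up to an element of [V]; after multiplication by [b], the term
    [v b ^ 2] falls back into [V] because [b ^ 2] is a scalar. *)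
Lemma good_idealizer_stable b : good b ->
  (idealizer V b * (V + V * <[b]>) <= V + V * <[b]>)%VS.
Proof.
move=> gb; apply/prodvP=> w _ Ww /memv_addP[c Vc [_ /memv_cosetP[e Ve ->] ->]].
have [u Vu def_c] := good_mul gb Ww Vc; have [v Vv def_e] := good_mul gb Ww Ve.
have -> : w * (c + e * b) = (w * c - u * b + b ^+ 2 * v) + (u + (w * e - v * b)) * b.
  by ring.
apply: memv_add; first by rewrite memvD ?V_sqrl.
by apply: memv_mul (memv_line b); rewrite memvD.
Qed.

(** The field generated by [W_b] acts on a space of dimension [6m = 3 * 2 ^ (s + 1)]. Its own
    dimension is a power of 2 dividing this, hence at most [2m], which [W_b] already attains. *)
Lemma good_field b : good b ->
  exists2 P : {subfield L}, P = idealizer V b :> {vspace L} & b \in P.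
Proof.
move=> gb; have /andP[Vb /eqP dimb] := gb.
have stabP := agenv_modl (good_idealizer_stable gb).
pose P := [aspace of agenv (idealizer V b)].
have [t dimP] := dim_subfield_expn2 sqr1 P.
have := field_module_dimS (stabP : (P * _ <= _)%VS).
rewrite good_extension_dim // dimP => dvd6.
have sWP : (idealizer V b <= P)%VS by apply: sub_agenv.
have le_t : (t <= s.+1)%N.
  have : (2 ^ t %| 2 ^ s.+1)%N.
    rewrite -(@Gauss_dvdl _ _ 3) ?coprimeXl //.
    by rewrite expnS mulnAC.
  by rewrite dvdn_Pexp2l.
exists P.
  apply/esym/eqP; rewrite eqEdim sWP /= -/(agenv _) -[agenv _]/(P : {vspace L}) dimP dimb.
  by rewrite -expnS leq_exp2l.
by rewrite (subvP sWP) // mem_idealizer Vb -expr2 -[_ ^+ 2]mulr1 V_sqrl.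
Qed.

(** The field [P R] lies in [V + V b], of dimension [6m], and contains [P(c)], of dimension [4m];
    degrees being powers of 2, the two fields agree. So [w] in [R] is [p + q c] with [p, q] in [P],
    and [q c = w - p] in [V] puts [q] in [R]. Hence [P + R] is the direct sum of [P] and
    [(P :&: R) c], and counting dimensions gives [m]. *)
Lemma good_pair b c (P R : {subfield L}) : good b -> good c ->
    P = idealizer V b :> {vspace L} -> R = idealizer V c :> {vspace L} ->
  c \notin P -> \dim (P :&: R) = m.
Proof.
move=> gb gc defP defR P'c; have [/andP[Vb /eqP dimb] /andP[Vc /eqP dimc]] := (gb, gc).
have Rc : c \in R by rewrite defR mem_idealizer Vc -expr2 -[_ ^+ 2]mulr1 V_sqrl.
have dimPc := dim_Fadjoin_sqr sqr1 P'c.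
have sPc : (<<P; c>> <= P * R)%VS.
  by apply/FadjoinP; rewrite field_subvMr (subvP (field_subvMl P R)).
have sRV : (R <= V)%VS by rewrite defR idealizer_sub.
have le_PR : (\dim (P * R) <= 6 * m)%N.
  rewrite -(good_extension_dim gb); apply/dimvS.
  rewrite {1}defP; apply: subv_trans (good_idealizer_stable gb).
  by apply/prodvSr/(subv_trans sRV)/addvSl.
have eqPR : <<P; c>>%VS = (P * R)%VS.
  have [t dimPR] := dim_subfield_pow2 sqr1 sPc.
  apply/eqP; rewrite eqEdim sPc /= dimPR /= dimPc.
  move: le_PR; rewrite dimPR /= dimPc defP dimb.
  case: t {dimPR} => [|t]; first by rewrite mul1n.
  rewrite !mulnA leq_pmul2r // expnSr -!mulnA leqNgt => /negP[].
  by rewrite (@leq_trans (1 * 8)) // leq_pmul2r // expn_gt0.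
have sub_sum : (P + R <= P + (P :&: R) * <[c]>)%VS.
  rewrite subv_add addvSl; apply/subvP=> w Rw.
  have : w \in <<P; c>>%VS by rewrite eqPR (subvP (field_subvMl P R)).
  case/(Fadjoin_sqrP sqr1)=> p Pp [q Pq def_w].
  rewrite def_w memv_add // memv_mul ?memv_line // memv_cap Pq defR mem_idealizer.
  have Vq : q \in V by apply: (subvP (idealizer_sub V b)); rewrite -defP.
  have Vp : p \in V by apply: (subvP (idealizer_sub V b)); rewrite -defP.
  have -> : q * c = w - p by rewrite def_w addrC addKr.
  by rewrite Vq rpredB // (subvP sRV).
have eq_sum : (P + R = P + (P :&: R) * <[c]>)%VS.
  apply/eqP; rewrite eqEsubv sub_sum addvS //.
  apply/prodvP=> q _ Qq /vlineP[a ->]; rewrite -scalerAr memvZ // memvM //.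
  exact: (subvP (capvSr P R)).
have dim_sum : \dim (P + R) = (2 * m + \dim (P :&: R))%N.
  have sQPP : ((P :&: R)%AS * P <= P)%VS.
    by rewrite -[X in (_ <= X)%VS]prodv_id prodvSl ?capvSl.
  rewrite eq_sum dimv_disjoint_sum ?(cap_coset_eq0 sQPP) //.
  rewrite dim_cosetv ?defP ?dimb //.
  by apply: contraNneq P'c => ->; rewrite mem0v.
have := dimv_sum_cap P R; rewrite dim_sum {3}defP defR dimb dimc -addnA => /addnI.
by rewrite addnn -mul2n => /eqP; rewrite eqn_pmul2l // => /eqP.
Qed.

(** Write [Q] for [P :&: R]. The pencil lemma for [(b, c)] in the direction [(0, e)] gives [Q e]
    inside [P c + V]. This is sharpened to [Q e] inside [V] for good [e] outside [P(c)], and such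
    [e] suffice by linearity. *)
Lemma good_pair_stable b c (P R : {subfield L}) : good b -> good c ->
    P = idealizer V b :> {vspace L} -> R = idealizer V c :> {vspace L} ->
    b \in P -> c \notin P ->
  ((P :&: R) * V <= V)%VS.
Proof.
move=> gb gc defP defR Pb P'c.
have [/andP[Vb /eqP dimb] /andP[Vc /eqP dimc]] := (gb, gc).
have nz_poly (p : {poly F}) : p.[0] != 0 -> p != 0.
  by apply: contraNneq => ->; rewrite horner0.
have sPV : (P <= V)%VS by rewrite defP idealizer_sub.
pose X : {vspace L} := <<P; c>>%VS.
(* If [V] were the field [P(c)], it would contain [c b], which would put [c] in [W_b = P]. *)
have notVX : ~~ (V <= X)%VS.
  apply: contra (P'c) => sVX.
  have dimX : \dim X = \dim V by rewrite dim_Fadjoin_sqr // defP dimb dimV mulnA.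
  have defV : V = X by apply/eqP; rewrite eqEdim sVX dimX /=.
  rewrite defP mem_idealizer Vc defV mulrC memvM ?memv_adjoin //.
  exact: subvP_adjoin.
(* Here [P] is generated by [b] over [P :&: T], since the degree is 2; its elements get components
   along [1] and [b]. *)
have basisP (T : {subfield L}) : b \notin T -> \dim (P :&: T) = m ->
    forall x, x \in P -> exists2 x0, x0 \in (P :&: T)%VS &
      exists2 x1, x1 \in (P :&: T)%VS & x = x0 + x1 * b.
  move=> T'b dimPT x Px; apply: (Fadjoin_sqrP sqr1 (K := [aspace of (P :&: T)%VS])).
  suff -> : <<(P :&: T)%VS; b>>%VS = P by [].
  apply/eqP; rewrite eqEdim; apply/andP; split.
    by apply/(@FadjoinP _ _ [aspace of (P :&: T)%VS] b P); rewrite capvSl.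
  rewrite (@dim_Fadjoin_sqr _ _ sqr1 [aspace of (P :&: T)%VS]) /=.
    by rewrite dimPT {1}defP dimb.
  by rewrite memv_cap Pb.
have notinT (T : {subfield L}) e : e \in V -> e \notin P ->
    T = idealizer V e :> {vspace L} -> b \notin T.
  move=> Ve P'e ->; apply: contra P'e.
  by rewrite mem_idealizer Vb /= defP mem_idealizer Ve mulrC.
(* For generic [t], [good_pair] applies to [b] and [c + t e], so the intersection keeps dimension
   [m] on the line. The zero direction at [b] forces [u b] into [V], that is, [u] into [P]. *)
have Q_pencil q e : q \in (P :&: R)%VS -> e \in V ->
    exists2 u, u \in P & q * e - u * c \in V.
  move=> Qq Ve; have [p p0 pP] := good_line gc Ve.
  have [r r0 rP] := line_off e P'c.
  have [|t||u [Vu]] := @idealizer2_pencil _ _ V Finf b 0 c e (p * r) q.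
  - by rewrite mulf_neq0 ?nz_poly.
  - rewrite hornerM mulf_eq0 negb_or scaler0 addr0 => /andP[/pP gct /rP P'ct].
    have [T defT _] := good_field gct.
    by rewrite -defP -defR -defT (good_pair gb gc) // (good_pair gb gct).
  - by rewrite -defP -defR.
  rewrite mulr0 sub0r rpredN => Vub Vqu; exists u => //.
  by rewrite defP mem_idealizer Vu.
(* The components of [q * e - u * c] along [b] give [(q1 e - u1 c) b] in [V], so
   [q1 e - u1 c] is in [P]; as [e] is not in [P(c)], [q1 = 0] and [q] is in
   the idealizer of [e]. *)
have Q_generic q e : q \in (P :&: R)%VS -> good e -> e \notin X -> q * e \in V.
  move=> Qq ge X'e; have /andP[Ve _] := ge.
  have P'e : e \notin P by apply: contra X'e; apply: subvP_adjoin.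
  have [T defT _] := good_field ge.
  have [u Pu Vqu] := Q_pencil q e Qq Ve.
  have Pq : q \in P by apply: (subvP (capvSl P R)).
  have [q0 Tq0 [q1 Tq1 def_q]] :=
    basisP T (notinT T e Ve P'e defT) (good_pair gb ge defP defT P'e) q Pq.
  have [u0 Ru0 [u1 Ru1 def_u]] :=
    basisP R (notinT R c Vc P'c defR) (good_pair gb gc defP defR P'c) u Pu.
  have TV x : x \in (P :&: T)%VS -> x * e \in V.
    by rewrite memv_cap defT mem_idealizer => /and3P[].
  have RV x : x \in (P :&: R)%VS -> x * c \in V.
    by rewrite memv_cap defR mem_idealizer => /and3P[].
  have Px : q1 * e - u1 * c \in P.
    rewrite defP mem_idealizer rpredB ?TV ?RV //=.
    have -> : (q1 * e - u1 * c) * b = (q * e - u * c) - (q0 * e - u0 * c).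
      by rewrite def_q def_u; ring.
    by rewrite rpredB // rpredB ?TV ?RV.
  have Pq1 : q1 \in P by apply: (subvP (capvSl P T)).
  have Pu1 : u1 \in P by apply: (subvP (capvSl P R)).
  have [q10 | nz_q1] := eqVneq q1 0.
    by rewrite def_q q10 mul0r addr0 TV.
  case/negP: X'e; have -> : e = q1^-1 * ((q1 * e - u1 * c) + u1 * c).
    by rewrite subrK mulKf.
  apply: memvM; first by rewrite memvV subvP_adjoin.
  rewrite memvD ?(subvP_adjoin c Px) //.
  by apply: memvM (memv_adjoin P c); apply: subvP_adjoin.
(* Any [e] in [V] is a multiple of the difference of two good elements outside [X], namely
   [e0 + t e] and [e0] with [t] generic and nonzero. *)
apply/prodvP=> q e Qq Ve.
have [e0 ge0 X'e0] := good_avoid gb notVX.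
have [p p0 pP] := good_line ge0 Ve; have [r r0 rP] := line_off e X'e0.
have [|t] := Finf (p := p * r * 'X).
  by rewrite !mulf_neq0 ?polyX_eq0 ?nz_poly.
rewrite !hornerM hornerX !mulf_eq0 !negb_or -andbA => /and3P[/pP get /rP X'et t0].
have -> : q * e = t^-1 *: (q * (e0 + t *: e) - q * e0).
  by rewrite -mulrBr addrC addKr -scalerAr scalerA mulVf ?scale1r.
by rewrite memvZ // rpredB ?Q_generic.
Qed.

(** Take [Q = P :&: R], so that [P = Q(b)] and [Q(b, c)] has dimension [4m]. [V] is not this field,
    for otherwise [c b] would lie in [V] and [c] in [P]. Any [e] of [V] outside it supplies the
    fourth summand and the last doubling of the degree. *)
Lemma half_idealizer_structure b : good b ->
  exists (Q : {subfield L}) (x y z : L),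
    [/\ \dim Q = m, V = (Q + Q * <[x]> + Q * <[y]> + Q * <[z]>)%VS
      & \dim <<<<<<Q; x>>; y>>; z>> = (8 * m)%N].
Proof.
move=> gb; have [P defP Pb] := good_field gb.
have [/andP[Vb /eqP dimb]] := gb.
have notVP : ~~ (V <= P)%VS.
  apply/negP=> /dimvS; rewrite defP dimb dimV leq_pmul2r //.
have [c gc P'c] := good_avoid gb notVP; have [R defR Rc] := good_field gc.
have /andP[Vc _] := gc.
pose Q := [aspace of (P :&: R)%VS].
have dimQ : \dim Q = m by apply: good_pair gb gc defP defR P'c.
have sQV : (Q * V <= V)%VS by apply: good_pair_stable gb gc defP defR Pb P'c.
have Q'b : b \notin Q.
  rewrite memv_cap Pb /=; apply: contra P'c.
  by rewrite defR defP !mem_idealizer Vb Vc mulrC.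
have dimQb := dim_Fadjoin_sqr sqr1 Q'b.
have defQb : <<Q; b>>%VS = P.
  apply/eqP; rewrite eqEdim dimQb dimQ {2}defP dimb leqnn andbT.
  by apply/FadjoinP; rewrite capvSl.
have Qb'c : c \notin [aspace of <<Q; b>>%VS] by rewrite /= defQb.
have dimQbc := dim_Fadjoin_sqr sqr1 Qb'c.
have sum3 : (Q + Q * <[b]> + Q * <[c]> <= <<<<Q; b>>; c>>)%VS.
  rewrite (Fadjoin_sqrE sqr1 [aspace of <<Q; b>>%VS] c) /= -(Fadjoin_sqrE sqr1 Q b).
  by rewrite addvS // prodvSl // subv_adjoin.
have sQV1 x : x \in V -> (Q * <[x]> <= V)%VS.
  by move=> Vx; apply: subv_trans sQV; rewrite prodvSr.
have sum3V : (Q + Q * <[b]> + Q * <[c]> <= V)%VS.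
  by rewrite !subv_add !sQV1 // -[X in (X <= V)%VS]prodv1 sQV1.
have notVX : ~~ (V <= <<<<Q; b>>; c>>)%VS.
  apply: contra (P'c) => sVX.
  have dimX : \dim V = \dim <<<<Q; b>>; c>>%VS.
    by rewrite dimQbc /= dimQb dimQ dimV mulnA.
  have defV : V = <<<<Q; b>>; c>>%VS by apply/eqP; rewrite eqEdim sVX dimX /=.
  rewrite defP mem_idealizer Vc defV.
  rewrite (memvM (A := [aspace of <<<<Q; b>>; c>>%VS])) ?memv_adjoin //.
  by rewrite subvP_adjoin // memv_adjoin.
have /subvPn[e Ve X'e] := notVX.
exists Q, b, c, e; split=> //; last first.
  by rewrite (dim_Fadjoin_sqr sqr1 (K := [aspace of <<<<Q; b>>; c>>%VS])) //= dimQbc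
    /= dimQb dimQ !mulnA.
have Qmod1 x : (Q * (Q * <[x]>) <= Q * <[x]>)%VS by rewrite prodvA prodv_id.
have nz x (X : {vspace L}) : x \notin X -> x != 0.
  by apply: contraNneq => ->; rewrite mem0v.
apply/esym/eqP; rewrite eqEdim subv_add sum3V sQV1 //= dimV.
rewrite dimv_disjoint_sum; last first.
  apply: cap_coset_eq0; last by apply: contra X'e; apply/subvP.
  by rewrite !prodvDr !addvS ?prodv_id.
rewrite dimv_disjoint_sum; last first.
  apply: cap_coset_eq0; last by rewrite -(Fadjoin_sqrE sqr1).
  by rewrite !prodvDr !addvS ?prodv_id.
rewrite dimv_disjoint_sum ?cap_coset_eq0 ?asubv //.
rewrite !dim_cosetv ?(nz _ _ X'e) ?(nz _ _ P'c) ?(nz _ _ Q'b) // dimQ.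
by rewrite !mulSn mul0n addn0 !addnA.
Qed.

End HalfIdealizers.

(** * The converse: idealizers in a module over a subfield *)

Section ModuleIdealizers.
Variables (F : fieldType) (L : fieldExtType F).
Hypothesis sqr1 : forall y : L, y ^+ 2 \in 1%VS.
Variables (V : {vspace L}) (S : {subfield L}).
Hypotheses (V1 : 1 \in V) (SV : (S * V <= V)%VS).
Hypothesis dimV : \dim V = (4 * \dim S)%N.
Implicit Types b u w x : L.

Let memSV x w : x \in S -> w \in V -> x * w \in V.
Proof. by move=> Sx Vw; apply: (subvP SV); rewrite memv_mul. Qed.

Let sqrS x : x ^+ 2 \in S.
Proof. exact: subvP (sub1v S) _ (sqr1 x). Qed.

Let adjoin_idealizer b : b \in V -> (<<S; b>> <= idealizer V b)%VS.
Proof.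
move=> Vb; apply/subvP=> w /(Fadjoin_sqrP sqr1)[p Sp [q Sq ->]].
have SV1 x : x \in S -> x \in V by move=> Sx; rewrite -[x]mulr1 memSV.
rewrite mem_idealizer mulrDl -mulrA -expr2.
rewrite rpredD ?(SV1 p) ?(memSV _ Vb) //=.
by rewrite rpredD ?(memSV _ Vb) // memSV // SV1.
Qed.

Lemma module_idealizer_ge b : b \in V -> (2 * \dim S <= \dim (idealizer V b))%N.
Proof.
move=> Vb; have [Sb | S'b] := boolP (b \in S).
  apply: leq_trans (_ : \dim V <= _)%N; first by rewrite dimV leq_mul2r orbT.
  by apply/dimvS/subvP=> w Vw; rewrite mem_idealizer Vw mulrC memSV.
by rewrite -(dim_Fadjoin_sqr sqr1 S'b) dimvS ?adjoin_idealizer.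
Qed.

(** Any [b] in [V] outside [S] works: if [u] in [W_b] were outside [S(b)], the field [S(b, u)] would
    lie in [V] and have the same dimension. *)
Lemma module_idealizer_eq : (forall E : {subfield L}, E <> V :> {vspace L}) ->
  exists2 b, b \in V & \dim (idealizer V b) = (2 * \dim S)%N.
Proof.
move=> notfieldV.
have /subvPn[b Vb S'b] : ~~ (V <= S)%VS.
  apply/negP=> /dimvS; rewrite dimV -[X in (_ <= X)%N]mul1n leq_pmul2r //.
  exact: adim_gt0.
have dimSb := dim_Fadjoin_sqr sqr1 S'b.
exists b => //; rewrite -dimSb; congr (\dim _); apply/eqP.
rewrite eqEsubv adjoin_idealizer // andbT; apply: contraT => /subvPn[u Wu Sb'u].
case: (notfieldV [aspace of <<<<S; b>>; u>>%VS]); apply/eqP.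
rewrite eqEdim /= (dim_Fadjoin_sqr sqr1 (K := [aspace of <<S; b>>%VS])) //=.
rewrite dimSb dimV mulnA leqnn andbT.
move: Wu; rewrite mem_idealizer => /andP[Vu Vub].
apply/subvP=> w /(Fadjoin_sqrP sqr1 (K := [aspace of <<S; b>>%VS]))[p Sbp [q Sbq ->]].
rewrite rpredD //; first exact: subvP (idealizer_sub V b) _ (subvP (adjoin_idealizer Vb) _ Sbp).
have [q0 Sq0 [q1 Sq1 ->]] := Fadjoin_sqrP sqr1 Sbq.
have -> : (q0 + q1 * b) * u = q0 * u + q1 * (u * b) by ring.
by apply: rpredD; apply: memSV.
Qed.

End ModuleIdealizers.

(** * Function fields of quasilinear forms *)

Section MpolyGeneric.
Variables (F : fieldType).
Hypothesis Finf : forall p : {poly F}, p != 0 -> exists s, p.[s] != 0.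

(** All coefficients of [p] can be read off from [muni p], so [muni p] is nonzero when [p] is; this
    starts the induction in [mpoly_eval_neq0]. *)
Lemma mcoeff_muni n (p : {mpoly F[n.+1]}) (m : 'X_{1..n.+1}) :
  ((muni p)`_(m ord_max))@_[multinom m (widen_ord (leqnSn n) i) | i < n] = p@_m.
Proof.
rewrite muniE coef_sum raddf_sum /=.
rewrite [RHS](_ : _ = \sum_(k <- msupp p) p@_k * (k == m)%:R); last first.
  rewrite {1}[p]mpolyE raddf_sum /=.
  by apply: eq_bigr => k _; rewrite mcoeffZ mcoeffX.
apply: eq_bigr => k _; rewrite coefZ coefXn -scalerAl mcoeffZ; congr (_ * _).
have [-> | neq_km] := eqVneq k m; first by rewrite eqxx mulr1 mcoeffX eqxx.
have [eq_max | _] := eqVneq (m ord_max) (k ord_max); last by rewrite mulr0 mcoeff0.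
rewrite mulr1 mcoeffX; case: eqP => // eq_w; case/eqP: neq_km.
apply/mnmP=> i; have [j ->|->] := unliftP ord_max i; last by [].
move/mnmP/(_ j): eq_w; rewrite !mnmE.
by have -> : widen_ord (leqnSn n) j = lift ord_max j by apply/val_inj; rewrite /= /bump leqNgt ltn_ord.
Qed.

(** View [p] as a polynomial in its last variable: first specialise the other variables so that the
    leading coefficient survives, then the last one. *)
Lemma mpoly_eval_neq0 n (p : {mpoly F[n]}) : p != 0 -> exists v, p.@[v] != 0.
Proof.
elim: n p => [|n IHn] p nz_p.
  have all0 (m : 'X_{1..0}) : m = 0%MM by apply/mnmP; case.
  have def_p : p = (p@_0)%:MP.
    by apply/mpolyP=> m; rewrite mcoeffC (all0 m) eqxx mulr1.
  by exists (fun=> 0); rewrite def_p mevalC -(mpolyC_eq0 0) -def_p.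
have nz_q : muni p != 0.
  apply: contraNneq nz_p => q0; apply/eqP/mpolyP=> m.
  by rewrite -mcoeff_muni q0 coef0 !mcoeff0.
have [|v nz_v] := IHn (lead_coef (muni p)); first by rewrite lead_coef_eq0.
have [|t nz_t] := Finf (p := map_poly (meval v) (muni p)).
  apply: contraNneq nz_v => q0.
  by rewrite lead_coefE -[_.@[v]](coef_map (meval v)) q0 coef0.
exists (fun i => if unlift ord_max i is Some j then v j else t).
apply: contraNneq nz_t => p0; rewrite -[X in _ == X]p0; apply/eqP.
rewrite muniE rmorph_sum horner_sum mevalE /=; apply: eq_bigr => m _.
rewrite map_polyZ map_polyXn hornerZ hornerXn /= mevalZ mevalX -mulrA; congr (_ * _).
rewrite big_ord_recr /= unlift_none; congr (_ * _).
apply: eq_bigr => i _; rewrite mnmE.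
have -> : widen_ord (leqnSn n) i = lift ord_max i.
  by apply/val_inj; rewrite /= /bump leqNgt ltn_ord.
by rewrite liftK.
Qed.
End MpolyGeneric.

Lemma fraction_repr (A : idomainType) (x : {fraction A}) :
  exists2 d : A, d != 0 & exists n : A, x = tofrac n / tofrac d.
Proof.
elim/quotW: x => y; exists (\d_y); first exact: denom_ratioP.
exists (\n_y); apply: canRL (mulfK _) _; first by rewrite tofrac_eq0 denom_ratioP.
unlock FracField.tofrac; rewrite -[LHS]FracField.pi_mul; apply/eqmodP=> /=.
by rewrite /FracField.equivf /FracField.mulf !numden_Ratio ?mulf_neq0 ?oner_neq0
  ?denom_ratioP // !mulr1 mulrC.
Qed.

Lemma common_denominator (A : idomainType) (I : finType) (u : I -> {fraction A}) :
  exists2 g : A, g != 0 & exists h : I -> A, forall i, u i * tofrac g = tofrac (h i).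
Proof.
have /fin_all_exists[d dP] (i : I) : exists nd : A * A, nd.2 != 0 /\ u i = tofrac nd.1 / tofrac nd.2.
  by have [d nz_d [n def_u]] := fraction_repr (u i); exists (n, d).
exists (\prod_i (d i).2); first by apply/prodf_neq0=> i _; case: (dP i).
exists (fun i => (d i).1 * \prod_(j | j != i) (d j).2) => i.
have [nz_d ->] := dP i; rewrite (bigD1 i) //= !rmorphM /= mulrA divfK //.
by rewrite tofrac_eq0.
Qed.

(** Clear denominators and specialise the variables where one chosen coordinate stays nonzero: a
    zero over the rational function field yields one over [F]. *)
Lemma anisotropic_generic (F : fieldType) n (I : finType) (a : I -> F) :
    (forall p : {poly F}, p != 0 -> exists s, p.[s] != 0) ->
  anisotropic a -> anisotropic (fun i => tofrac (a i)%:MP_[n]).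
Proof.
move=> Finf an u u0 i; have [g nz_g [h def_h]] := common_denominator u.
suff h0 : h i = 0.
  apply/eqP; move/eqP: (def_h i).
  by rewrite h0 rmorph0 mulf_eq0 tofrac_eq0 (negPf nz_g) orbF.
have sum0 : \sum_i (a i)%:MP_[n] * h i ^+ 2 = 0.
  apply/eqP; rewrite -tofrac_eq0.
  suff -> : tofrac (\sum_i (a i)%:MP_[n] * h i ^+ 2)
            = qf (fun i => tofrac (a i)%:MP_[n]) u * tofrac g ^+ 2.
    by rewrite u0 mul0r.
  rewrite rmorph_sum /qf mulr_suml; apply: eq_bigr => j _.
  by rewrite rmorphM rmorphXn /= -def_h exprMn mulrA.
apply/eqP; apply: contraT => /(mpoly_eval_neq0 Finf)[t /eqP[]].
apply: (an (fun j => (h j).@[t])); move/(congr1 (meval t)): sum0.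
rewrite meval0 => sum0_t; rewrite -[RHS]sum0_t rmorph_sum /qf /=.
by apply: eq_bigr => j _; rewrite mevalM mevalC rmorphXn.
Qed.

(** The fraction field of [A] modulo the common kernel is [K], so [g p / g q] may be sent to
    [h p / h q]. This compares two models of a function field. *)
Lemma rmorph_extension (A : comNzRingType) (K K' : fieldType)
    (g : {rmorphism A -> K}) (h : {rmorphism A -> K'}) :
    (forall p, g p = 0 <-> h p = 0) ->
    (forall z, exists p q, g q != 0 /\ z = g p / g q) ->
  exists f : {rmorphism K -> K'}, forall p, f (g p) = h p.
Proof.
move=> ker_gh surj_g.
have nz p : (g p != 0) = (h p != 0).
  by apply/idP/idP; apply: contra_neq => /ker_gh.
have /all_sig[rep repP] z : {pq : A * A | g pq.2 != 0 /\ z = g pq.1 / g pq.2}.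
  apply: ClassicalEpsilon.constructive_indefinite_description.
  by have [p [q pqP]] := surj_g z; exists (p, q).
pose f z := h (rep z).1 / h (rep z).2.
have fE p q : g q != 0 -> f (g p / g q) = h p / h q.
  move=> nz_q; rewrite /f; set z := g p / g q; have [nz_r def_z] := repP z.
  apply/eqP; rewrite eqr_div -?nz //; apply/eqP/subr0_eq.
  rewrite -!rmorphM -rmorphB; apply/ker_gh; rewrite rmorphB !rmorphM.
  apply/eqP; rewrite subr_eq0 -eqr_div //; apply/eqP.
  by rewrite -def_z.
have fg p : f (g p) = h p.
  by rewrite -[g p]divr1 -(rmorph1 g) fE ?rmorph1 ?oner_neq0 ?divr1.
have f_zmod : zmod_morphism f.
  move=> x y; have [nz_x {1}->] := repP x; have [nz_y {1}->] := repP y.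
  rewrite -mulNr -rmorphN addf_div // -!rmorphM -rmorphD fE ?rmorphM ?mulf_neq0 //.
  by rewrite rmorphD !rmorphM rmorphN -addf_div -?nz // mulNr.
have f_mon : monoid_morphism f.
  split=> [|x y]; first by rewrite -(rmorph1 g) fg rmorph1.
  have [nz_x {1}->] := repP x; have [nz_y {1}->] := repP y.
  by rewrite mulf_div -!rmorphM fE ?rmorphM ?mulf_neq0 // mulf_div.
pose fA := GRing.isZmodMorphism.Build K K' f f_zmod.
pose fM := GRing.isMonoidMorphism.Build K K' f f_mon.
by exists (HB.pack_for {rmorphism K -> K'} f fA fM).
Qed.

Lemma pboolP (P : Prop) : reflect P (pbool P).
Proof. by rewrite /pbool; case: ClassicalDescription.excluded_middle_informative => ?; constructor. Qed.

(** * The isotropy index and its dependence on the field *)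

Section IsotropyIndex.
Variables (K : fieldType) (d : nat) (a : 'I_d -> K).
Implicit Types (y : 'rV[K]_d).

Lemma lin_indepP m (v : 'I_m -> 'I_d -> K) :
  lin_indep v <-> row_free (\matrix_(j, i) v j i).
Proof.
split=> [indep | freeM c sum0].
  set M := (\matrix_(j, i) v j i).
  rewrite -kermx_eq0; apply/eqP/row_matrixP=> k; rewrite row0; apply/rowP=> j.
  rewrite [RHS]mxE; move: j.
  apply: (indep (fun j => row k (kermx M) 0 j)) => i.
  have /sub_kermxP/rowP/(_ i) : (row k (kermx M) <= kermx M)%MS by apply: row_sub.
  rewrite mxE [X in _ = X]mxE => sum0; rewrite -[RHS]sum0.
  by apply: eq_bigr => l _; rewrite [M l i]mxE.
move=> j; have /rowP/(_ j) : \row_j c j = 0.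
  apply: (row_free_inj freeM); apply/rowP=> i; rewrite mul0mx !mxE -[RHS](sum0 i).
  by apply: eq_bigr => l _; rewrite !mxE.
by rewrite !mxE.
Qed.

Lemma indep_zeros_leq_i0 m : has_indep_zeros a m -> (m <= i0 a)%N.
Proof.
move=> zeros; have le_md : (m < #|'I_d|.+1)%N.
  have [v [_ /lin_indepP/eqP <-]] := zeros.
  by rewrite ltnS card_ord rank_leq_col.
by apply: (@leq_bigmax_cond _ _ val (Ordinal le_md)); apply/pboolP.
Qed.

Lemma i0_indep_zeros : has_indep_zeros a (i0 a).
Proof.
have zeros0 : pbool (has_indep_zeros a (@ord0 #|'I_d|)).
  by apply/pboolP; exists (fun=> fun=> 0); split=> [[] | c _ []].
pose P := [pred m : 'I_#|'I_d|.+1 | pbool (has_indep_zeros a m)].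
have [|m /pboolP zeros def_m] := @eq_bigmax_cond _ P (@nat_of_ord _).
  by apply/card_gt0P; exists ord0.
by rewrite /i0 [X in has_indep_zeros a X]def_m.
Qed.

Lemma i0_anisotropic : anisotropic a -> i0 a = 0%N.
Proof.
move=> an; have [v [v0]] := i0_indep_zeros; case: (i0 a) v v0 => // m v v0.
move=> indep; suff /eqP : 1 = 0 :> K by rewrite oner_eq0.
apply: (indep (fun=> 1) _ ord0) => i.
by apply: big1 => j _; rewrite (an _ (v0 j)) mulr0.
Qed.

Hypothesis K2 : 2%N \in [pchar K].

Lemma sqrD (x y : K) : (x + y) ^+ 2 = x ^+ 2 + y ^+ 2.
Proof. exact: (pFrobenius_autD_comm K2 (mulrC x y)). Qed.

Lemma sqr_sum (I : finType) (u : I -> K) : (\sum_i u i) ^+ 2 = \sum_i u i ^+ 2.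
Proof. exact: (rmorph_sum (pFrobenius_aut K2)). Qed.

Lemma qf_mulmx m (c : 'rV_m) (M : 'M_(m, d)) :
  qf a ((c *m M) 0) = \sum_j c 0 j ^+ 2 * qf a (M j).
Proof.
rewrite /qf; under eq_bigr do rewrite mxE sqr_sum mulr_sumr.
rewrite exchange_big /=; apply: eq_bigr => j _; rewrite mulr_sumr.
by apply: eq_bigr => i _; rewrite exprMn mulrCA.
Qed.

(** A zero outside the row space of a largest independent family of zeros could be appended to it,
    exceeding [i0 a]. *)
Lemma i0_basis : exists M : 'M_(i0 a, d),
  [/\ row_free M, forall j, qf a (M j) = 0
    & forall y, qf a (y 0) = 0 -> (y <= M)%MS].
Proof.
have [v [v0 /lin_indepP freeM]] := i0_indep_zeros.
set M := (\matrix_(j, i) v j i) in freeM.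
have M0 j : qf a (M j) = 0.
  by rewrite -[RHS](v0 j); apply: eq_bigr => i _; rewrite mxE.
exists M; split=> // y y0; apply: contraT => My.
have rk : \rank (col_mx M y) = (i0 a + 1)%N.
  apply/eqP; rewrite eqn_leq rank_leq_row /= [X in (X <= _)%N]addn1.
  have : (M < M + y)%MS by rewrite ltmxE addsmxSl addsmx_sub submx_refl.
  by rewrite ltmxErank => /andP[_]; rewrite addsmxE (eqP freeM).
have : has_indep_zeros a (i0 a + 1).
  exists (fun j i => (col_mx M y) j i); split=> [j|].
    have [k ->|k ->] := split_ordP j.
      by rewrite -[RHS](M0 k); apply: eq_bigr => i _; rewrite col_mxEu.
    by rewrite -[RHS]y0; apply: eq_bigr => i _; rewrite col_mxEd ord1.
  apply/lin_indepP; rewrite /row_free -[X in _ == X]rk; apply/eqP; congr (\rank _).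
  by apply/matrixP=> i j; rewrite mxE.
by move/indep_zeros_leq_i0; rewrite addn1 ltnn.
Qed.

End IsotropyIndex.

Lemma i0_rmorph_leq (K K' : fieldType) (f : {rmorphism K -> K'}) d
    (a : 'I_d -> K) (a' : 'I_d -> K') :
  (forall i, f (a i) = a' i) -> (i0 a <= i0 a')%N.
Proof.
move=> faE.
apply: indep_zeros_leq_i0; have [v [v0 /lin_indepP freeM]] := i0_indep_zeros a.
exists (fun j i => f (v j i)); split=> [j|].
  rewrite -[RHS](rmorph0 f) -(v0 j) rmorph_sum; apply: eq_bigr => i _.
  by rewrite rmorphM rmorphXn faE.
apply/lin_indepP; rewrite -(row_free_map f) in freeM.
by move: freeM; congr (is_true (row_free _)); apply/matrixP=> i j; rewrite !mxE.
Qed.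

(** Two models of the function field map into each other over [F], and [i0] can only grow along a
    morphism. Thus [i1_eq] may be tested on one model. *)
Lemma i0_function_field (F : fieldType) d (a : 'I_d -> F) (K K' : fieldType)
    (iota : {rmorphism F -> K}) x (iota' : {rmorphism F -> K'}) x' :
    is_function_field a iota x -> is_function_field a iota' x' ->
  i0 (fun i => iota (a i)) = i0 (fun i => iota' (a i)).
Proof.
wlog suff le : K K' iota x iota' x' / is_function_field a iota x ->
    is_function_field a iota' x' ->
    (i0 (fun i => iota (a i)) <= i0 (fun i => iota' (a i)))%N.
  by move=> fx fx'; apply/eqP; rewrite eqn_leq (le _ _ _ _ _ _ fx fx') (le _ _ _ _ _ _ fx' fx).
move=> [x0 kerx surjx] [x'0 kerx' surjx'].
have [|p|f fE] := @rmorph_extension _ _ _ (mmap iota x) (mmap iota' x').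
- move=> p; split=> [/kerx[q ->] | /kerx'[q ->]].
    by rewrite rmorphM /= x'0 mulr0.
  by rewrite rmorphM /= x0 mulr0.
- exact: surjx.
have fiota c : f (iota c) = iota' c by have /= := fE c%:MP; rewrite !mmapC.
exact: (i0_rmorph_leq (f := f)).
Qed.

Lemma mpoly_ind_ring (R : comNzRingType) n (P : {mpoly R[n]} -> Prop) :
    (forall c, P c%:MP) -> (forall p q, P p -> P q -> P (p + q)) ->
    (forall p i, P p -> P (p * 'X_i)) ->
  forall p, P p.
Proof.
move=> PC PD PX p; rewrite [p]mpolyE.
elim/big_rec: _ => [|m q _ Pq]; first by rewrite -mpolyC0.
apply: PD => //; move: (PC p@_m) => {q Pq}.
rewrite -mul_mpolyC mpolyXE_id.
move: (p@_m)%:MP => c; move: c; elim/big_rec: _ => [c | i q _ IHq c] Pc.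
  by rewrite mulr1.
rewrite mulrA; apply: IHq; elim: (m i) => [|k IHk]; first by rewrite mulr1.
by rewrite exprSr mulrA; apply: PX.
Qed.

(** A quadratic polynomial without roots is irreducible; [1, z] is a basis of the field that
    [X ^ 2 - b] defines. *)
Lemma sqrt_extension (R : fieldType) (b : R) : (forall y, y ^+ 2 != b) ->
  exists (L : fieldExtType R) (z : L), [/\ z ^+ 2 = b%:A,
    forall y, exists u v, y = u%:A + v *: z &
    forall u v, u%:A + v *: z = 0 -> u = 0 /\ v = 0].
Proof.
move=> not_sqr; pose p := 'X^2 - b%:P : {poly R}.
have szp : size p = 3%N by rewrite size_XnsubC.
have irr : irreducible_poly p.
  apply: cubic_irreducible; rewrite ?szp // => y.
  by rewrite rootE !hornerE subr_eq0.
have [L dimL [z rootz _]] := irredp_FAdjoin irr.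
have z2 : z ^+ 2 = b%:A.
  move: rootz; rewrite rmorphB /= map_polyXn map_polyC rootE !hornerE /=.
  by rewrite subr_eq0 => /eqP.
have indep u v : u%:A + v *: z = 0 -> u = 0 /\ v = 0.
  have [-> | nz_v] := eqVneq v 0.
    by rewrite scale0r addr0 => /eqP; rewrite scaler_eq0 oner_eq0 orbF => /eqP.
  move/eqP; rewrite addr_eq0 => /eqP def_u; case/eqP: (not_sqr (u / v)).
  apply: (fmorph_inj (in_alg L)); rewrite /= -z2.
  have -> : z = - ((u / v)%:A).
    by rewrite mulrC -scalerA def_u scalerN scalerA mulVf // scale1r opprK.
  by rewrite sqrrN exprZn expr1n.
exists L, z; split=> // y.
have free1z : free [:: 1; z].
  rewrite free_cons seq1_free span_seq1; apply/andP; split.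
    apply/negP=> /vlineP[v def1]; have [] := indep 1 (- v).
      by rewrite scale1r scaleNr -def1 subrr.
    by move/eqP; rewrite oner_eq0.
  apply: contraTneq isT => z0; have [] := indep 0 1.
    by rewrite z0 scale0r scaler0 addr0.
  by move=> _ /eqP; rewrite oner_eq0.
have : y \in span [:: 1; z].
  suff -> : span [:: 1; z] = fullv by rewrite memvf.
  apply/eqP; rewrite eqEdim subvf dimL szp.
  by move: free1z; rewrite /free => /eqP->.
rewrite span_cons span_seq1 => /memv_addP[_ /vlineP[u ->] [_ /vlineP[v ->] ->]].
by exists u, v.
Qed.

Lemma anisotropic_neq0 (K : fieldType) (I : finType) (a : I -> K) i :
  anisotropic a -> a i != 0.
Proof.
move=> an; apply: contraTneq isT => ai0; pose v k : K := (k == i)%:R.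
have : qf a v = 0.
  rewrite /qf (bigD1 i) //= ai0 mul0r add0r big1 // => k ki.
  by rewrite /v (negPf ki) expr0n mulr0.
by move/an/(_ i)/eqP; rewrite /v eqxx oner_eq0.
Qed.

(** * A model of the function field: a square root over rational functions *)

Section GenericFunctionField.
Variables (F : fieldType) (r : nat) (a : 'I_r.+1 -> F).
Hypothesis F2 : 2%N \in [pchar F].
Hypothesis Finf : forall p : {poly F}, p != 0 -> exists s, p.[s] != 0.
Hypotheses (an_a : anisotropic a) (r_gt0 : (0 < r)%N).

Local Notation R := {fraction {mpoly F[r]}}.
Local Notation c i := (a i / a ord0).

Definition fracC : {rmorphism F -> R} := (@tofrac {mpoly F[r]} \o @mpolyC r F).
Definition fracX i : R := tofrac 'X_i.
(* The value that [phi x = 0] forces on [x_0 ^ 2], where [x_(i + 1) = fracX i]. *)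
Definition generic_ratio : R := \sum_(i < r) fracC (c (lift ord0 i)) * fracX i ^+ 2.

Let a0 : a ord0 != 0. Proof. exact: anisotropic_neq0. Qed.

Lemma R_pchar : 2%N \in [pchar R].
Proof. by rewrite (rmorph_pchar fracC) // F2. Qed.

Lemma anisotropic_ratios : anisotropic (fun i => c i).
Proof.
move=> v v0 i; apply: an_a; rewrite -[RHS](mulr0 (a ord0)) -v0 mulr_sumr.
by apply: eq_bigr => j _; rewrite mulrA [a ord0 * _]mulrC divfK.
Qed.

(** A square root [y] would make [(y, X_1, ..., X_r)] a zero of the normalised form, which stays
    anisotropic over [R]. *)
Lemma generic_ratio_nonsquare y : y ^+ 2 != generic_ratio.
Proof.
apply/eqP=> y2; have an := anisotropic_generic (n := r) Finf anisotropic_ratios.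
pose v i : R := if unlift ord0 i is Some j then fracX j else y.
have : qf (fun i => tofrac (c i)%:MP_[r]) v = 0.
  rewrite /qf big_ord_recl divff // /v unlift_none mul1r y2.
  rewrite (eq_bigr (fun i => fracC (c (lift ord0 i)) * fracX i ^+ 2)); last first.
    by move=> i _; rewrite liftK.
  by rewrite addrr_pchar2 // R_pchar.
move/an/(_ (lift ord0 (Ordinal r_gt0))); rewrite /v liftK => /eqP.
by rewrite tofrac_eq0 -msupp_eq0 msuppX.
Qed.

Section SquareRootExtension.
Variables (L : fieldExtType R) (z : L).
Hypothesis z2 : z ^+ 2 = generic_ratio%:A.
Hypothesis L_gen : forall y : L, exists u v, y = u%:A + v *: z.
Hypothesis L_free : forall u v, u%:A + v *: z = 0 -> u = 0 /\ v = 0.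

Definition ffC : {rmorphism F -> L} := (in_alg L \o fracC).
Definition ffX (i : 'I_r.+1) : L :=
  if unlift ord0 i is Some j then (fracX j)%:A else z.

Let em : {rmorphism {mpoly F[r]} -> {mpoly F[r.+1]}} :=
  mmap (@mpolyC r.+1 F) (fun j => 'X_(lift ord0 j)).
Let ev : {rmorphism {mpoly F[r.+1]} -> L} := mmap ffC ffX.

Let ev_em p : ev (em p) = (tofrac p)%:A.
Proof.
elim/mpoly_ind_ring: p => [e|p q IHp IHq|p i IHp].
- by rewrite /em /ev /= mmapC mmapC.
- by rewrite !rmorphD IHp IHq /= scalerDl.
rewrite !rmorphM IHp /= -scalerAl mul1r -scalerA; congr (_ *: _).
by rewrite /em mmapX mmap1U mmapX mmap1U /ffX liftK.
Qed.

Let phi' : {mpoly F[r]} := \sum_(i < r) a (lift ord0 i) *: 'X_i ^+ 2.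

Let emC e : em e%:MP = e%:MP.
Proof. by rewrite /em /= mmapC. Qed.

Let emX i : em 'X_i = 'X_(lift ord0 i).
Proof. by rewrite /em /= mmapX mmap1U. Qed.

Let evX0 : ev 'X_ord0 = z.
Proof. by rewrite /ev /= mmapX mmap1U /ffX unlift_none. Qed.

Let phiE : qf_poly a = (a ord0)%:MP * 'X_ord0 ^+ 2 + em phi'.
Proof.
rewrite /qf_poly big_ord_recl mul_mpolyC; congr (_ + _).
rewrite /phi' rmorph_sum; apply: eq_bigr => i _.
by rewrite -!mul_mpolyC rmorphM rmorphXn emX emC.
Qed.

Let ev_phi : ev (qf_poly a) = 0.
Proof.
have F2L : 2%N \in [pchar L] by rewrite (rmorph_pchar (in_alg L)) // R_pchar.
rewrite phiE rmorphD rmorphM rmorphXn evX0 ev_em z2.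
have -> : ev (a ord0)%:MP = (fracC (a ord0))%:A by rewrite /ev /= mmapC.
rewrite mulr_algl scalerA -scalerDl.
suff -> : fracC (a ord0) * generic_ratio = tofrac phi'.
  by rewrite (addrr_pchar2 R_pchar) scale0r.
rewrite /generic_ratio mulr_sumr rmorph_sum; apply: eq_bigr => i _.
by rewrite mulrA -rmorphM [a ord0 * _]mulrC divfK // -mul_mpolyC rmorphM rmorphXn.
Qed.

Let ev_linear A B : ev (em A + em B * 'X_ord0) = (tofrac A)%:A + tofrac B *: z.
Proof. by rewrite rmorphD rmorphM !ev_em evX0 mulr_algl. Qed.

(** Division by the form as a quadratic polynomial in [X_0] whose leading coefficient [a_0] is a
    unit; the remainder is linear in [X_0]. *)
Let divide p : exists q r0 r1, p = q * qf_poly a + em r0 + em r1 * 'X_ord0.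
Proof.
elim/mpoly_ind_ring: p => [e|p q [q1 [r0 [r1 ->]]] [q2 [s0 [s1 ->]]]|p i [q [r0 [r1 ->]]]].
- by exists 0, e%:MP, 0; rewrite mul0r add0r rmorph0 mul0r addr0 emC.
- exists (q1 + q2), (r0 + s0), (r1 + s1); rewrite !rmorphD !mulrDl.
  by rewrite addrACA [X in X + _ = _]addrACA.
rewrite !mulrDl; have [j ->|->] := unliftP ord0 i.
  exists (q * 'X_(lift ord0 j)), (r0 * 'X_j), (r1 * 'X_j); rewrite !rmorphM !emX.
  by congr (_ + _ + _); apply: mulrAC.
(* The new term [r1 X_0 ^ 2] is reduced by [a_0 X_0 ^ 2 = phi - phi']. *)
exists (q * 'X_ord0 + em r1 * (a ord0)^-1%:MP), (r1 * (a ord0)^-1%:MP * - phi'), r0.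
have X02 : 'X_ord0 ^+ 2 = (a ord0)^-1%:MP * qf_poly a + (a ord0)^-1%:MP * em (- phi').
  by rewrite -mulrDr phiE rmorphN addrK mulrA -mpolyCM mulVf // mul1r.
rewrite -[em r1 * _ * _]mulrA -expr2 X02 !rmorphM emC mulrDr !mulrA mulrDl mulrAC.
by rewrite -!addrA; congr (_ + _); rewrite addrC -addrA.
Qed.

(** After division by the form, a polynomial in the kernel has remainder [A + B X_0] with
    [A + B z = 0], and [1, z] are independent over [R]. *)
Lemma generic_function_field : is_function_field a ffC ffX.
Proof.
split; first exact: ev_phi.
  move=> p; rewrite -[mmap _ _ p]/(ev p); have [q [r0 [r1 ->]]] := divide p.
  rewrite -addrA rmorphD rmorphM ev_phi mulr0 add0r ev_linear.
  case/L_free=> /eqP r00 /eqP r10; exists q.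
  move: r00 r10; rewrite !tofrac_eq0 => /eqP-> /eqP->.
  by rewrite rmorph0 mul0r !addr0.
move=> y; have [u [v ->]] := L_gen y.
have [d nz_d [n ->]] := fraction_repr u; have [e nz_e [m ->]] := fraction_repr v.
exists (em (n * e) + em (m * d) * 'X_ord0), (em (d * e)).
rewrite -![mmap _ _ _]/(ev _) ev_linear ev_em.
have nz_de : tofrac (d * e) != 0 by rewrite tofrac_eq0 mulf_neq0.
have nz_deA : (tofrac (d * e))%:A != 0 :> L by rewrite scaler_eq0 oner_eq0 orbF.
split=> //; apply: canRL (mulfK nz_deA) _.
rewrite [LHS]mulrC mulr_algl scalerDr !scalerA !rmorphM.
have clear_den (x t w : R) : x != 0 -> x * t * (w / x) = w * t.
  by move=> nz_x; rewrite mulrC mulrA divfK.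
congr (_ *: _ + _ *: _); first by rewrite clear_den ?tofrac_eq0.
by rewrite [tofrac d * _]mulrC clear_den ?tofrac_eq0.
Qed.

End SquareRootExtension.
End GenericFunctionField.

(** * Matrices over a quadratic extension as pairs of matrices *)

Section SquareRootMatrices.
Variables (R : fieldType) (L : fieldExtType R) (z : L) (b : R).
Hypothesis z2 : z ^+ 2 = b%:A.
Hypothesis L_gen : forall y : L, exists u v, y = u%:A + v *: z.
Hypothesis L_free : forall u v, u%:A + v *: z = 0 -> u = 0 /\ v = 0.

Definition pairmx m n (U W : 'M[R]_(m, n)) : 'M[L]_(m, n) :=
  map_mx (in_alg L) U + z *: map_mx (in_alg L) W.

Lemma pairmxE m n (U W : 'M[R]_(m, n)) i j :
  pairmx U W i j = (U i j)%:A + W i j *: z.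
Proof. by rewrite !mxE /= mulrC mulr_algl. Qed.

Lemma pairmx_surj m n (Y : 'M[L]_(m, n)) : exists U W, Y = pairmx U W.
Proof.
have /fin_all_exists[f fP] (ij : 'I_m * 'I_n) : exists uv : R * R,
    Y ij.1 ij.2 = uv.1%:A + uv.2 *: z.
  by have [u [v ->]] := L_gen (Y ij.1 ij.2); exists (u, v).
exists (\matrix_(i, j) (f (i, j)).1), (\matrix_(i, j) (f (i, j)).2).
by apply/matrixP=> i j; rewrite pairmxE !mxE (fP (i, j)).
Qed.

Lemma pairmx_eq0 m n (U W : 'M[R]_(m, n)) : pairmx U W = 0 -> U = 0 /\ W = 0.
Proof.
move=> /matrixP UW0; split; apply/matrixP=> i j.
  by have := UW0 i j; rewrite pairmxE !mxE => /L_free[].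
by have := UW0 i j; rewrite pairmxE !mxE => /L_free[].
Qed.

Lemma pairmxB m n (U W U' W' : 'M[R]_(m, n)) :
  pairmx U W - pairmx U' W' = pairmx (U - U') (W - W').
Proof. by rewrite /pairmx !map_mxB scalerBr opprD addrACA. Qed.

Lemma pairmx_inj m n (U W U' W' : 'M[R]_(m, n)) :
  pairmx U W = pairmx U' W' -> U = U' /\ W = W'.
Proof.
move/eqP; rewrite -subr_eq0 pairmxB => /eqP/pairmx_eq0[/eqP + /eqP].
by rewrite !subr_eq0 => /eqP-> /eqP->.
Qed.

Lemma mul_pairmx m n p (A B : 'M[R]_(m, n)) (U W : 'M[R]_(n, p)) :
  pairmx A B *m pairmx U W = pairmx (A *m U + b *: (B *m W)) (A *m W + B *m U).
Proof.
rewrite /pairmx !map_mxD map_mxZ !map_mxM mulmxDl !mulmxDr -!scalemxAl -!scalemxAr.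
rewrite scalerA -expr2 z2 scalerDr -!addrA; congr (_ + _).
by rewrite [RHS]addrC -addrA.
Qed.

End SquareRootMatrices.
Arguments pairmx {R L} z {m n}.

(** * The first isotropy index as a generic rank *)

Section RankFormula.
Import VectorInternalTheory.
Variables (F : fieldType) (r : nat) (a : 'I_r.+1 -> F).
Hypothesis F2 : 2%N \in [pchar F].
Hypothesis Finf : forall p : {poly F}, p != 0 -> exists s, p.[s] != 0.
Hypotheses (an_a : anisotropic a) (r_gt0 : (0 < r)%N).
Variables (M : fieldExtType F) (j : {rmorphism M -> F}).
Hypothesis jA : forall c : F, j c%:A = c ^+ 2.
Variable v : r.+1.-tuple M.
Hypothesis jv : forall i : 'I_r.+1, j v`_i = a i / a ord0.

Local Notation R := {fraction {mpoly F[r]}}.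
Local Notation iota := (@fracC F r).
Local Notation X := (@fracX F r).
Local Notation d := r.+1.
Local Notation D := (dim M).
Let b : R := generic_ratio a.
Let V : {vspace M} := span v.

Let R2 : 2%N \in [pchar R] := R_pchar r F2.

Let jZ c y : j (c *: y) = c ^+ 2 * j y.
Proof. by rewrite -mulr_algl rmorphM jA. Qed.

(** Under [j] a linear relation among the [v_i] becomes a zero of the normalised anisotropic
    form. *)
Lemma free_ratios : free v.
Proof.
apply/freeP=> k sum0 i; apply: (anisotropic_ratios an_a (v := k)).
rewrite -[RHS](rmorph0 j) -sum0 rmorph_sum; apply: eq_bigr => l _.
by rewrite jZ jv mulrC.
Qed.

(** The map [j] is itself an anisotropic quasilinear form on the [F]-space [M]. [Phi] is its
    extension to [R], and [phi], the normalised form, is the restriction of [Phi] to [V] in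
    coordinates on [v]. *)
Let Phi (u : 'rV[R]_D) : R := qf (fun l => iota (j (r2v (delta_mx 0 l)))) (u 0).
Let phi (q : 'rV[R]_d) : R := qf (fun i : 'I_d => iota (a i / a ord0)) (q 0).

Let Phi_eq0 u : Phi u = 0 -> u = 0.
Proof.
have an_j : anisotropic (fun l : 'I_D => j (r2v (delta_mx 0 l))).
  move=> w w0 l; suff /rowP/(_ l) : \row_l w l = 0 by rewrite !mxE.
  apply: (@r2v_inj _ M); apply: (fmorph_inj j); rewrite linear0 rmorph0 -[RHS]w0.
  rewrite (row_sum_delta (\row_l w l)) linear_sum rmorph_sum; apply: eq_bigr => k _.
  by rewrite linearZ jZ mxE mulrC.
move=> u0; apply/rowP=> l; rewrite mxE.
exact: (anisotropic_generic Finf an_j) u0 l.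
Qed.

Let phi_eq0 q : phi q = 0 -> q = 0.
Proof.
move=> q0; apply/rowP=> l; rewrite mxE.
exact: (anisotropic_generic Finf (anisotropic_ratios an_a)) q0 l.
Qed.

Let Phi_sum (I : finType) (u : I -> 'rV[R]_D) : Phi (\sum_i u i) = \sum_i Phi (u i).
Proof.
rewrite /Phi /qf exchange_big; apply: eq_bigr => l _ /=.
by rewrite summxE (sqr_sum R2) mulr_sumr.
Qed.

Let Phi_const t y : Phi (t *: map_mx iota (v2r y)) = t ^+ 2 * iota (j y).
Proof.
have -> : j y = \sum_l (v2r y) 0 l ^+ 2 * j (r2v (delta_mx 0 l)).
  rewrite -{1}[y]v2rK {1}[v2r y]row_sum_delta linear_sum rmorph_sum.
  by apply: eq_bigr => l _; rewrite linearZ jZ.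
rewrite rmorph_sum mulr_sumr; apply: eq_bigr => l _.
by rewrite !mxE rmorphM rmorphXn exprMn [RHS]mulrA mulrC.
Qed.

Let B : 'M[R]_(d, D) := map_mx iota (b2mx v).

Let row_B i : row i B = map_mx iota (v2r v`_i).
Proof. by rewrite -map_row /b2mx rowK (tnth_nth 0). Qed.

Let Phi_B q : Phi (q *m B) = phi q.
Proof.
rewrite mulmx_sum_row Phi_sum; apply: eq_bigr => i _.
by rewrite row_B Phi_const jv mulrC.
Qed.

(** Multiplication of [V] by the generic element, the sum of the [X_i v_(i + 1)], splits into [A],
    its part outside [V], and [G], its part inside [V] in coordinates on [v]. *)
Let A : 'M[R]_(d, D) := \sum_(i < r) X i *: map_mx iota (offmx V v v`_(lift ord0 i)).
Let G : 'M[R]_(d, d) :=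
  \sum_(i < r) X i *: map_mx iota (\matrix_(h, k)
     coord v k (projv V (v`_h * v`_(lift ord0 i)))).

Let row_AGB h : row h (A + G *m B) =
  \sum_(i < r) X i *: map_mx iota (v2r (v`_h * v`_(lift ord0 i))).
Proof.
rewrite linearD /= row_mul {1}/A !linear_sum /= mulmx_suml -big_split /=.
apply: eq_bigr => i _; rewrite !linearZ /= -scalemxAl -scalerDr; congr (_ *: _).
rewrite -!map_row -map_mxM -map_mxD; congr map_mx.
rewrite /offmx rowK -[in RHS](subrK (projv V (v`_h * v`_(lift ord0 i))) (_ * _)).
rewrite [RHS]linearD; congr (_ + _).
apply: (@r2v_inj _ M); rewrite v2rK -sum_b2mx [RHS](coord_span (memv_proj V _)).
by apply: eq_bigr => k _; rewrite !mxE.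
Qed.

(** As [j] is multiplicative, multiplying by the generic element multiplies values by its own value
    [b]. *)
Let Phi_AGB q : Phi (q *m (A + G *m B)) = b * phi q.
Proof.
rewrite mulmx_sum_row Phi_sum /phi /qf mulr_sumr; apply: eq_bigr => h _.
rewrite row_AGB scaler_sumr Phi_sum /b /generic_ratio mulr_suml.
apply: eq_bigr => i _; rewrite scalerA Phi_const rmorphM !jv rmorphM exprMn.
by rewrite [LHS]mulrC mulrACA mulrC.
Qed.

Let Off : 'M[F]_D := lin1_mx (v2r \o off V \o r2v).

Let mul_Off y : v2r y *m Off = v2r (off V y).
Proof. by rewrite mul_rV_lin1 /= v2rK. Qed.

Let off_off y : off V (off V y) = off V y.
Proof.
by rewrite {1}/off; have : projv V (off V y) = 0; [
  rewrite /off linearB /= projv_proj subrr | move->; rewrite subr0].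
Qed.

Let A_Off : A *m map_mx iota Off = A.
Proof.
rewrite mulmx_suml; apply: eq_bigr => i _; rewrite -scalemxAl -map_mxM.
congr (_ *: map_mx _ _); apply/row_matrixP=> h.
by rewrite row_mul rowK mul_Off off_off.
Qed.

Let B_Off : B *m map_mx iota Off = 0.
Proof.
apply/row_matrixP=> i; rewrite row_mul row_B row0 -map_mxM mul_Off.
have /eqP-> : off V v`_i == 0 by rewrite off_eq0 memv_span // mem_nth ?size_tuple.
by rewrite linear0 map_mx0.
Qed.

(** If [q A = 0], the generic multiple of [q] stays in [V] and has value [b * phi q]. Conversely,
    that multiple and [p B] have equal values, so they coincide as [Phi] is additive and
    anisotropic; [Off] then kills everything in [V]. *)
Lemma kernel_generic_offmx q : q *m A = 0 <-> exists p, phi p = b * phi q.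
Proof.
split=> [qA0 | [p eq_pq]].
  by exists (q *m G); rewrite -Phi_AGB mulmxDr qA0 add0r mulmxA Phi_B.
have : Phi (q *m (A + G *m B) + p *m B) = 0.
  have := Phi_sum (fun c : bool => if c then q *m (A + G *m B) else p *m B).
  rewrite !big_bool /= => ->; rewrite Phi_AGB Phi_B eq_pq.
  exact: (addrr_pchar2 R2).
move/Phi_eq0/(congr1 (mulmx^~ (map_mx iota Off))).
rewrite mul0mx mulmxDl -!mulmxA B_Off mulmx0 addr0 mulmxDl A_Off -mulmxA B_Off.
by rewrite mulmx0 addr0.
Qed.

Section ZerosOverExtension.
Variables (L : fieldExtType R) (z : L).
Hypothesis z2 : z ^+ 2 = b%:A.
Hypothesis L_gen : forall y : L, exists u v, y = u%:A + v *: z.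
Hypothesis L_free : forall u v, u%:A + v *: z = 0 -> u = 0 /\ v = 0.
Let aL (i : 'I_d) : L := @ffC F r L (a i).

Let qf_pair p q : qf aL (pairmx z p q 0) = 0 <-> phi p = b * phi q.
Proof.
have L2 : 2%N \in [pchar L] by rewrite (rmorph_pchar (in_alg L)) // R2.
have a0 := anisotropic_neq0 ord0 an_a.
have -> : qf aL (pairmx z p q 0) = (iota (a ord0) * (phi p + b * phi q))%:A.
  rewrite /phi /qf mulr_sumr -big_split mulr_sumr scaler_suml; apply: eq_bigr => i _.
  rewrite pairmxE (sqrD L2) !exprZn expr1n z2 scalerA -scalerDl /aL /ffC /=.
  rewrite mulr_algl scalerA -{1}[a i](divfK a0) rmorphM; congr (_ *: _).
  by rewrite [b * _]mulrCA -mulrDr mulrCA mulrA [b * _]mulrC rmorphM.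
split=> [/eqP | ->]; last by rewrite (addrr_pchar2 R2) mulr0 scale0r.
rewrite scaler_eq0 oner_eq0 orbF mulf_eq0 fmorph_eq0 (negPf a0) /=.
by rewrite addr_eq0 (oppr_pchar2 R2) => /eqP.
Qed.

(** A zero [p + z q] is determined by [q], which runs through the left kernel of [A]. A basis
    [U + z W] of the zeros over [L], together with its multiple by [z], has [q]-parts [W] and [U];
    these rows form a basis of the kernel over [R]. *)
Lemma i0_rank_generic : (i0 aL + i0 aL + \rank A = d)%N.
Proof.
have L2 : 2%N \in [pchar L] by rewrite (rmorph_pchar (in_alg L)) // R2.
have [Y [freeY zeroY maxY]] := i0_basis aL.
have [U [W defY]] := pairmx_surj L_gen Y.
have rowY k : pairmx z (row k U) (row k W) = row k Y.
  by apply/rowP=> i; rewrite defY [RHS]mxE !pairmxE !mxE.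
have zero_row (y : 'rV[L]_d) : (y <= Y)%MS -> qf aL (y 0) = 0.
  case/submxP=> c ->; rewrite (qf_mulmx _ L2) big1 // => k _.
  by rewrite zeroY mulr0.
have zero_pair p q : (pairmx z p q <= Y)%MS -> phi p = b * phi q.
  by move=> /zero_row/qf_pair.
have combine (al be : 'rV[R]_(i0 aL)) :
    (pairmx z (al *m U + b *: (be *m W)) (al *m W + be *m U) <= Y)%MS.
  by rewrite -(mul_pairmx z2) defY submxMl.
have subK : (col_mx W U <= kermx A)%MS.
  have inK q : (exists p, phi p = b * phi q) -> (q <= kermx A)%MS.
    by move/kernel_generic_offmx/sub_kermxP.
  rewrite -addsmxE addsmx_sub; apply/andP; split; apply/row_subP=> k; apply: inK.
    exists (row k U); apply: zero_pair; rewrite rowY; exact: row_sub.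
  exists (0 *m U + b *: (delta_mx 0 k *m W)); rewrite [row k U](_ : _ = 0 *m W + delta_mx 0 k *m U).
    by apply: zero_pair; apply: combine.
  by rewrite mul0mx add0r rowE.
have eqK : (col_mx W U == kermx A)%MS.
  rewrite subK; apply/row_subP=> k.
  have /kernel_generic_offmx[p eq_p] : row k (kermx A) *m A = 0.
    by apply/sub_kermxP/row_sub.
  have /submxP[c] : (pairmx z p (row k (kermx A)) <= Y)%MS by apply/maxY/qf_pair.
  have [al [be ->]] := pairmx_surj L_gen c.
  rewrite defY (mul_pairmx z2) => /(pairmx_inj L_free)[_ ->].
  by rewrite -addsmxE addmx_sub_adds ?submxMl.
(* A vanishing [q]-part gives [phi p = 0], hence [p = 0]; the combination is then zero over [L],
   where the rows of [Y] are free. *)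
have freeWU : row_free (col_mx W U).
  rewrite -kermx_eq0; apply/eqP/row_matrixP=> k; rewrite row0.
  have : row k (kermx (col_mx W U)) *m col_mx W U = 0 by apply/sub_kermxP/row_sub.
  rewrite -[row k _]hsubmxK; move: (lsubmx _) (rsubmx _) => al be.
  rewrite mul_row_col => sum0; have := combine al be; rewrite sum0 => sub0.
  have := zero_pair _ _ sub0; rewrite /phi /qf [X in _ = _ * X]big1 => [|i _]; last first.
    by rewrite mxE expr0n mulr0.
  rewrite mulr0 => /phi_eq0 p0.
  have /(pairmx_eq0 L_free)[-> ->] : pairmx z al be = 0; last by rewrite row_mx0.
  apply: (row_free_inj freeY); rewrite mul0mx defY (mul_pairmx z2) p0 sum0.
  by rewrite /pairmx !map_mx0 scaler0 addr0.
have := mxrank_ker A; rewrite -(eqmxP eqK) (eqP freeWU) => ->.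
by rewrite subnK ?rank_leq_row.
Qed.

End ZerosOverExtension.
Let v0 : v`_0 = 1.
Proof.
by apply: (fmorph_inj j); rewrite (jv ord0) rmorph1 divff // anisotropic_neq0.
Qed.

Let V1 : 1 \in V.
Proof. by rewrite -v0 memv_span // mem_nth ?size_tuple. Qed.

Let offmx1 : offmx V v v`_0 = 0.
Proof.
apply/row_matrixP=> h; rewrite rowK row0 v0 mulr1; apply/eqP.
by rewrite v2r_off_eq0 memv_span // mem_nth ?size_tuple.
Qed.

(** [A] with its entries taken back to polynomials, so that the variables can be specialised to
    elements of [F]. *)
Let AX : 'M[{mpoly F[r]}]_(d, D) :=
  \sum_(i < r) 'X_i *: map_mx (@mpolyC r F) (offmx V v v`_(lift ord0 i)).

Let AX_frac : map_mx (@tofrac {mpoly F[r]}) AX = A.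
Proof.
apply/matrixP=> h l; rewrite mxE !summxE rmorph_sum; apply: eq_bigr => i _.
by rewrite !mxE rmorphM.
Qed.

Let det_AX k (f : 'I_k -> 'I_d) (g : 'I_k -> 'I_D) :
  \det (mxsub f g A) = tofrac (\det (mxsub f g AX)).
Proof. by rewrite -AX_frac -map_mxsub det_map_mx. Qed.

Let AX_eval (t : 'I_r -> F) :
  map_mx (meval t) AX = offmx V v (\sum_(i < r) t i *: v`_(lift ord0 i)).
Proof.
rewrite offmx_sum; apply/matrixP=> h l; rewrite mxE !summxE rmorph_sum.
by apply: eq_bigr => i _; rewrite !mxE /= mevalM mevalXU mevalC.
Qed.

(** The component of [y] along [v_0 = 1] preserves [V] and contributes nothing, so [offmx V v y] is
    a specialisation of [AX]; its nonzero minors lift. *)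
Lemma rank_offmx_leq_generic y : y \in V -> (\rank (offmx V v y) <= \rank A)%N.
Proof.
move=> Vy; pose t i := coord v (lift ord0 i) y.
have -> : offmx V v y = map_mx (meval t) AX.
  rewrite AX_eval {1}(coord_span Vy) !offmx_sum big_ord_recl /= offmx1 scaler0.
  by rewrite add0r.
have [f [g]] := max_minor_neq0 (map_mx (meval t) AX).
rewrite -map_mxsub det_map_mx => nz_t.
apply: (minor_leq_rank (f := f) (g := g)).
rewrite det_AX tofrac_eq0.
by apply: contraNneq nz_t => ->; rewrite rmorph0.
Qed.

Lemma rank_offmx_geq_generic :
  exists2 y, y \in V & (\rank A <= \rank (offmx V v y))%N.
Proof.
have [f [g]] := max_minor_neq0 A.
rewrite det_AX tofrac_eq0 => /(mpoly_eval_neq0 Finf)[t nz_t].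
exists (\sum_(i < r) t i *: v`_(lift ord0 i)).
  by apply: memv_suml => i _; rewrite memvZ // memv_span // mem_nth ?size_tuple.
rewrite -AX_eval; apply: (minor_leq_rank (f := f) (g := g)).
by rewrite -map_mxsub det_map_mx.
Qed.

(** With [i] the isotropy index over the model, [dim W_y - 2 i] is the drop of the rank at [y] below
    the generic rank. It is nonnegative, and zero for some [y]; moreover [i0 a = 0]. *)
Lemma i1_eq_idealizer k : i1_eq a k <->
  (forall y, y \in V -> (2 * k <= \dim (idealizer V y))%N) /\
  (exists2 y, y \in V & \dim (idealizer V y) = (2 * k)%N).
Proof.
have [L [z [z2 L_gen L_free]]] :=
  sqrt_extension (generic_ratio_nonsquare F2 Finf an_a r_gt0).
have ffL := generic_function_field F2 an_a z2 L_gen L_free.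
have rkA := i0_rank_generic z2 L_gen L_free.
set i := i0 _ in rkA.
have i1E : i1_eq a k <-> i = k.
  rewrite /i1_eq (i0_anisotropic an_a); split=> [i1k | <- K io x ffK].
    by rewrite -(i1k _ _ _ ffL) subn0.
  by rewrite subn0; apply: i0_function_field ffK ffL.
have basisV : basis_of V v by rewrite /basis_of eqxx free_ratios.
have dimW y := etrans (dim_idealizer y basisV) (esym rkA).
have ge_i y : y \in V -> (2 * i <= \dim (idealizer V y))%N.
  move=> Vy; rewrite -(leq_add2r (\rank (offmx V v y))) dimW mul2n -addnn.
  by rewrite leq_add2l rank_offmx_leq_generic.
have [y0 Vy0 rk_y0] := rank_offmx_geq_generic.
have eq_i : \dim (idealizer V y0) = (2 * i)%N.
  apply/eqP; rewrite eqn_leq ge_i // andbT -(leq_add2r (\rank (offmx V v y0))).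
  by rewrite dimW mul2n -addnn leq_add2l.
rewrite i1E; split=> [<- | [ge_k [y Vy eq_k]]]; first by split=> //; exists y0.
apply/eqP; rewrite -(eqn_pmul2l (isT : (0 < 2)%N)) eqn_leq.
by rewrite -{1}eq_k ge_i // -eq_i ge_k.
Qed.

End RankFormula.

(** * Norm fields and divisibility *)

Section Characteristic2.
Variable F : fieldType.
Hypothesis F2 : 2%N \in [pchar F].

Lemma sqrf_inj (x y : F) : x ^+ 2 = y ^+ 2 -> x = y.
Proof. exact: (fmorph_inj (pFrobenius_aut F2)). Qed.

(** Suppose [x ^ k = 1]. For odd [k], [x = x ^ (k + 1)] is a square; for even [k], injectivity of
    squaring allows [k] to be halved. *)
Lemma nonsquare_expr_neq1 (x : F) k :
  (forall y, y ^+ 2 != x) -> (0 < k)%N -> x ^+ k != 1.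
Proof.
move=> nsq; have [n] := ubnP k; elim: n k => // n IHn k le_kn k_gt0.
apply/eqP=> xk1; have def_k := odd_double_half k.
case: (odd k) def_k => def_k.
  have /eqP[] := nsq (x ^+ k./2.+1).
  rewrite -exprM muln2 doubleS -[RHS]mulr1 -xk1 -exprS; congr (_ ^+ _).
  by rewrite -[RHS]/(k.+1) -[in RHS]def_k.
have {}def_k : (k./2.*2 = k)%N := def_k.
have k2_gt0 : (0 < k./2)%N by rewrite -double_gt0 def_k.
have lt_k2n : (k./2 < n)%N.
  rewrite -ltnS; apply: leq_trans le_kn; rewrite ltnS -[ltnRHS]def_k -addnn.
  by rewrite -[ltnLHS]addn0 ltn_add2l.
case/eqP: (IHn _ lt_k2n k2_gt0).
by apply: sqrf_inj; rewrite -exprM muln2 def_k xk1 expr1n.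
Qed.

(** The powers of [x] are pairwise distinct, too many to be all roots of [p]. *)
Lemma nonsquare_poly_eval (x : F) : (forall y, y ^+ 2 != x) ->
  forall p : {poly F}, p != 0 -> exists s, p.[s] != 0.
Proof.
move=> nsq p nz_p; pose rs := [seq x ^+ i | i <- iota 0 (size p)].
have nz_x : x != 0 by apply: contraTneq (nsq 0) => ->; rewrite expr0n /= eqxx.
have uniq_rs : uniq rs.
  rewrite map_inj_in_uniq ?iota_uniq // => i k _ _.
  wlog lt_ik : i k / (i < k)%N => [suff eq_x|eq_x].
    case: (ltngtP i k) => // lt_; first exact: suff lt_ eq_x.
    exact/esym/(suff _ _ lt_)/esym.
  have k_i : (0 < k - i)%N by rewrite subn_gt0.
  case/eqP: (nonsquare_expr_neq1 nsq k_i).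
  by apply: (mulfI (expf_neq0 i nz_x)); rewrite -exprD subnKC 1?ltnW // mulr1.
have /allPn[s _ nz_s] : ~~ all (root p) rs.
  apply/negP=> /(max_poly_roots nz_p)/(_ uniq_rs).
  by rewrite size_map size_iota ltnn.
by exists s.
Qed.

(** If [a_1 / a_0] were [y ^ 2], then [(y, 1, 0, ..., 0)] would be a zero; so this ratio is a
    nonsquare. *)
Lemma anisotropic_poly_eval r (a : 'I_r.+1 -> F) : (0 < r)%N -> anisotropic a ->
  forall p : {poly F}, p != 0 -> exists s, p.[s] != 0.
Proof.
move=> r_gt0 an; pose i1 := lift ord0 (Ordinal r_gt0).
have a0 := anisotropic_neq0 ord0 an.
apply: (nonsquare_poly_eval (x := a i1 / a ord0)) => y; apply/eqP=> def_y.
pose w i := if i == ord0 then y else if i == i1 then 1 else 0.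
have : qf a w = 0.
  rewrite /qf (bigD1 ord0) //= (bigD1 i1) //= big1 => [|i /andP[i0 ii1]].
    rewrite /w /= def_y mulrC divfK // expr1n mulr1 addr0.
    exact: (addrr_pchar2 F2).
  by rewrite /w (negPf i0) (negPf ii1) expr0n mulr0.
by move/an/(_ i1)/eqP; rewrite /w /= oner_eq0.
Qed.

(* A finite extension of [F], acting on [F] through the Frobenius, models a
   finitely generated subfield of [F] containing [F ^ 2]. *)
Lemma Frobenius_extension (xs : seq F) :
  exists (M : fieldExtType F) (j : {rmorphism M -> F}),
    (forall c, j c%:A = c ^+ 2) /\ (forall x, x \in xs -> exists y, j y = x).
Proof.
elim: xs => [|x xs [M [j [jA j_xs]]]].
  exists F^o, (pFrobenius_aut F2 : {rmorphism F^o -> F}); split=> // c.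
  by rewrite /= pFrobenius_autE -[_%:A]/(c * 1) mulr1.
have [[y jy] | x_new] := ClassicalDescription.excluded_middle_informative (exists y, j y = x).
  exists M, j; split=> // x'; rewrite inE => /predU1P[->|/j_xs//].
  by exists y.
(* A preimage of [x] under [j] amounts to a square root of the scalar [x%:A], since [j] sends that
   scalar to [x ^ 2]. The next stage adjoins such a root [z] and maps it to [x]. *)
have nsq (y : M) : y ^+ 2 != x%:A.
  apply/eqP=> y2; case: x_new; exists y; apply: sqrf_inj.
  by rewrite -rmorphXn y2 jA.
have [L [z [z2 L_gen L_free]]] := sqrt_extension nsq.
have /all_sig[rep repP] y : {uv : M * M | y = uv.1%:A + uv.2 *: z}.
  apply: ClassicalEpsilon.constructive_indefinite_description.
  by have [u [v ->]] := L_gen y; exists (u, v).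
pose f y := j (rep y).1 + j (rep y).2 * x.
have fE u v : f (u%:A + v *: z) = j u + j v * x.
  rewrite /f; set y := u%:A + v *: z; have := repP y; rewrite {1}/y => /eqP.
  rewrite -subr_eq0 opprD addrACA -!scalerBl => /eqP/L_free[/eqP + /eqP].
  by rewrite !subr_eq0 => /eqP<- /eqP<-.
have f_zmod : zmod_morphism f.
  move=> y y'; rewrite {1}(repP y) {1}(repP y').
  rewrite opprD addrACA -!scalerBl fE !rmorphB mulrBl /f.
  by rewrite opprD [RHS]addrACA.
have f_mon : monoid_morphism f.
  split=> [|y y'].
    have -> : 1 = 1%:A + 0 *: z :> L by rewrite scale1r scale0r addr0.
    by rewrite fE rmorph1 rmorph0 mul0r addr0.
  rewrite {1}(repP y) {1}(repP y') -[f y]/(j (rep y).1 + j (rep y).2 * x).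
  rewrite -[f y']/(j (rep y').1 + j (rep y').2 * x); move: (rep y) (rep y') => [u v] [u' v'] /=.
  have -> : (u%:A + v *: z) * (u'%:A + v' *: z)
      = (u * u' + v * v' * x%:A)%:A + (u * v' + v * u') *: z.
    have algM (c e : M) : (c * e)%:A = c%:A * e%:A :> L := rmorphM (in_alg L) c e.
    rewrite -!(mulr_algl _ z) !scalerDl !algM -z2.
    rewrite !mulrDl !mulrDr [v%:A * z * (v'%:A * z)]mulrACA -expr2.
    rewrite [v%:A * z * u'%:A]mulrAC !mulrA -!addrA; congr (_ + _).
    by rewrite [RHS]addrC -addrA.
  rewrite fE !rmorphD !rmorphM jA /=; move: (j u) (j v) (j u') (j v') => U V U' V'.
  by ring.
pose fA := GRing.isZmodMorphism.Build L F f f_zmod.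
pose fM := GRing.isMonoidMorphism.Build L F f f_mon.
pose f' : {rmorphism L -> F} := HB.pack_for {rmorphism L -> F} f fA fM.
have fE1 u : f u%:A = j u.
  by rewrite -[u%:A]addr0 -(scale0r z) fE rmorph0 mul0r addr0.
exists (baseFieldType L), (f' : {rmorphism baseFieldType L -> F}); split=> [c|x'].
  by rewrite baseField_scaleE /= fE1 jA.
rewrite inE => /predU1P[->|/j_xs[y <-]]; last by exists y%:A; apply: fE1.
exists z; rewrite /= -[z]add0r -(scale0r 1) -[X in _ + X]scale1r fE.
by rewrite rmorph0 rmorph1 add0r mul1r.
Qed.

(** Both [y ^ 2] and the scalar [j y] are sent to [(j y) ^ 2] by the injective [j]. *)
Lemma Frobenius_sqr1 (M : fieldExtType F) (j : {rmorphism M -> F}) :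
  (forall c, j c%:A = c ^+ 2) -> forall y : M, y ^+ 2 \in 1%VS.
Proof.
move=> jA y; have -> : y ^+ 2 = (j y)%:A.
  by apply: (fmorph_inj j); rewrite rmorphXn jA.
by rewrite memvZ // mem1v.
Qed.

End Characteristic2.

(** * Families indexed by finite types, and isometries from changes of basis *)

Section Families.
Variables (F : fieldType) (vT : vectType F) (J : finType).
Implicit Types (w : J -> vT) (c : J -> F).

Let sum_codom w (k : J -> F) :
  \sum_(i < #|J|) k (enum_val i) *: (codom_tuple w)`_i = \sum_p k p *: w p.
Proof.
rewrite [RHS](reindex (@enum_val J predT)); last exact/onW_bij/enum_val_bij.
by apply: eq_bigr => i _; rewrite nth_image.
Qed.

Lemma free_codomP w :
  free (codom w) <-> (forall c, \sum_p c p *: w p = 0 -> forall p, c p = 0).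
Proof.
rewrite -[codom w]/(tval (codom_tuple w)); split=> [/freeP free_w c | free_w].
  rewrite -sum_codom => /free_w sum0 p.
  by have := sum0 (enum_rank p); rewrite enum_rankK.
apply/freeP=> k; pose c p := k (enum_rank p).
have kE i : k i = c (enum_val i) by rewrite /c enum_valK.
rewrite (eq_bigr (fun i => c (enum_val i) *: (codom_tuple w)`_i)) => [|i _].
  by rewrite sum_codom => /free_w c0 i; rewrite kE.
by rewrite -kE.
Qed.

Lemma mem_span_codom w u :
  u \in span (codom w) <-> exists c, u = \sum_p c p *: w p.
Proof.
split=> [| [c ->]]; last first.
  by apply: memv_suml => p _; rewrite memvZ // memv_span // codom_f.
rewrite -[codom w]/(tval (codom_tuple w)) => /coord_span->.
exists (fun p => coord (codom_tuple w) (enum_rank p) u); rewrite -sum_codom.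
by apply: eq_bigr => i _; rewrite enum_valK.
Qed.

End Families.

(** Both forms express the map [u |-> e * j u] on one subspace of [M]; the change-of-basis matrices
    are the isometry. *)
Lemma isometric_bases (F : fieldType) (M : fieldExtType F) (j : {rmorphism M -> F})
    (I J : finType) (v : I -> M) (w : J -> M) (e : F) (a : I -> F) (b : J -> F) :
    (forall c, j c%:A = c ^+ 2) -> free (codom v) -> free (codom w) ->
    span (codom v) = span (codom w) ->
    (forall i, a i = e * j (v i)) -> (forall p, b p = e * j (w p)) ->
  isometric a b.
Proof.
move=> jA /free_codomP free_v /free_codomP free_w eq_vw aE bE.
have /fin_all_exists[A vE] i : exists c, v i = \sum_p c p *: w p.
  by apply/mem_span_codom; rewrite -eq_vw memv_span // codom_f.
have /fin_all_exists[B wE] p : exists c, w p = \sum_i c i *: v i.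
  by apply/mem_span_codom; rewrite eq_vw memv_span // codom_f.
have delta (I' : finType) (x : I' -> M) i :
    x i = \sum_k (k == i)%:R *: x k.
  rewrite (bigD1 i) //= eqxx scale1r big1 ?addr0 // => k /negPf->.
  by rewrite scale0r.
exists (fun p i => A i p), (fun i p => B p i); split; [|split].
- move=> i i'; apply/eqP; rewrite -subr_eq0; apply/eqP.
  apply: (free_v (fun i => \sum_p B p i * A i' p - (i == i')%:R)).
  under eq_bigr do rewrite scalerBl scaler_suml.
  rewrite sumrB -delta exchange_big /=.
  rewrite [X in _ - X]vE -sumrB big1 // => p _.
  by under eq_bigr do rewrite mulrC -scalerA; rewrite -scaler_sumr -wE subrr.
- move=> p p'; apply/eqP; rewrite -subr_eq0; apply/eqP.
  apply: (free_w (fun p => \sum_i A i p * B p' i - (p == p')%:R)).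
  under eq_bigr do rewrite scalerBl scaler_suml.
  rewrite sumrB -delta exchange_big /= [X in _ - X]wE -sumrB big1 // => i _.
  by under eq_bigr do rewrite mulrC -scalerA; rewrite -scaler_sumr -vE subrr.
have qfE (I' : finType) (x : I' -> M) (f : I' -> F) c :
    (forall k, f k = e * j (x k)) -> qf f c = e * j (\sum_k c k *: x k).
  move=> fE; rewrite rmorph_sum mulr_sumr; apply: eq_bigr => k _.
  by rewrite fE -[_ *: x k]mulr_algl rmorphM jA -mulrA [j (x k) * _]mulrC.
move=> c; rewrite (qfE _ w) // (qfE _ v) //; congr (_ * j _).
under eq_bigr do rewrite scaler_suml.
rewrite exchange_big; apply: eq_bigr => i _ /=; rewrite [in RHS]vE scaler_sumr.
by apply: eq_bigr => p _; rewrite scalerA mulrC.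
Qed.

(** * Generators of subfields *)

Section SquareRootGenerators.
Variables (F : fieldType) (M : fieldExtType F).
Hypothesis sqr1 : forall y : M, y ^+ 2 \in 1%VS.

Lemma subfield_index2 (K E : {subfield M}) : (K <= E)%VS -> ~~ (E <= K)%VS ->
  exists (K' : {subfield M}) x, x \notin K' /\ <<K'; x>>%VS = E.
Proof.
have [n] := ubnP (\dim E - \dim K); elim: n K => // n IHn K le_n sKE /subvPn[x Ex K'x].
have sKxE : (<<K; x>> <= E)%VS by apply/FadjoinP.
have [sEKx | not_sEKx] := boolP (E <= <<K; x>>)%VS.
  by exists K, x; split=> //; apply/eqP; rewrite eqEsubv sKxE.
apply: (IHn [aspace of <<K; x>>%VS]) => //=.
rewrite -ltnS; apply: leq_trans le_n; rewrite ltnS ltn_sub2l //.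
  by rewrite (leq_trans _ (dimvS sKxE)) // dim_Fadjoin_sqr // mul2n -addnn
    -[ltnLHS]addn0 ltn_add2l adim_gt0.
by rewrite dim_Fadjoin_sqr // mul2n -addnn -[ltnLHS]addn0 ltn_add2l adim_gt0.
Qed.

Lemma subfield_generators t (E : {subfield M}) : \dim E = (2 ^ t)%N ->
  exists bs : t.-tuple M, <<1 & bs>>%VS = E.
Proof.
elim: t E => [|t IHt] E dimE.
  exists [tuple]; rewrite Fadjoin_nil; apply/eqP.
  by rewrite eqEdim sub1v dimE dimv1.
have [|K [x [K'x defE]]] := subfield_index2 (sub1v E).
  by apply/negP=> /dimvS; rewrite dimE dimv1 leqNgt -[X in (X < _)%N](expn0 2%N) ltn_exp2l.
have [|bs defK] := IHt K.
  apply/esym/eqP; have /eqP := dim_Fadjoin_sqr sqr1 K'x.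
  by rewrite defE dimE expnS eqn_pmul2l.
by exists [tuple of rcons bs x]; rewrite /= adjoin_rcons defK.
Qed.

(** Squarefree monomials suffice: multiplying by [be i] inserts [i] in [T], or removes it at the
    cost of the scalar [be i ^ 2]. *)
Lemma adjoin_products s (be : 'I_s -> M) :
  <<1 & codom be>>%VS = span (codom (fun T : {set 'I_s} => \prod_(i in T) be i)).
Proof.
set U := (X in _ = X); apply/eqP; rewrite eqEsubv; apply/andP; split; last first.
  apply/span_subvP=> _ /codomP[T ->]; apply: rpred_prod => i _.
  by apply: seqv_sub_adjoin; apply: codom_f.
have memU (T : {set 'I_s}) : \prod_(i in T) be i \in U.
  by apply/memv_span/codomP; exists T.
have U1 : 1 \in U by have := memU set0; rewrite big_set0.
apply: agenv_sub_modl; first exact: U1.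
rewrite prodvDl subv_add prod1v subvv /=.
apply/prodvP=> x y /mem_span_codom[c ->] /mem_span_codom[e ->].
rewrite mulr_suml memv_suml // => i _; rewrite mulr_sumr memv_suml // => T _.
rewrite -scalerAl -scalerAr !memvZ //; have [Ti | T'i] := boolP (i \in T).
  rewrite (bigD1 i) //= mulrA -expr2; have /vlineP[k ->] := sqr1 (be i).
  rewrite -scalerAl mul1r memvZ // (_ : \prod_(l in T | _) _ = \prod_(l in T :\ i) be l) //.
  by apply: eq_bigl => l; rewrite !inE andbC.
rewrite (_ : _ * _ = \prod_(l in i |: T) be l) //.
by rewrite big_setU1.
Qed.

End SquareRootGenerators.

(** * The norm field and divisibility read off from [V] *)

Section NormField.
Variables (F : fieldType) (r : nat) (a : 'I_r.+1 -> F).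
Hypotheses (F2 : 2%N \in [pchar F]) (an_a : anisotropic a).
Variables (M : fieldExtType F) (j : {rmorphism M -> F}).
Hypothesis jA : forall c : F, j c%:A = c ^+ 2.
Variable v : r.+1.-tuple M.
Hypothesis jv : forall i : 'I_r.+1, j v`_i = a i / a ord0.

Let V : {vspace M} := span v.
Let sqr1 := Frobenius_sqr1 jA.
Let a0 : a ord0 != 0. Proof. exact: anisotropic_neq0. Qed.

Let jZ c y : j (c *: y) = c ^+ 2 * j y.
Proof. by rewrite -mulr_algl rmorphM jA. Qed.

Let free_v : free v. Proof. exact (free_ratios an_a jA jv). Qed.

Lemma dim_span_ratios : \dim V = r.+1.
Proof. by move: free_v; rewrite /free size_tuple => /eqP. Qed.

Lemma span_ratios1 : 1 \in V.
Proof.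
have -> : 1 = v`_0 by apply: (fmorph_inj j); rewrite (jv ord0) rmorph1 divff.
by rewrite memv_span // mem_nth ?size_tuple.
Qed.

Lemma qf_ratios c : qf a c = a ord0 * j (\sum_i c i *: v`_i).
Proof.
rewrite rmorph_sum mulr_sumr; apply: eq_bigr => i _.
by rewrite jZ jv [RHS]mulrCA [a ord0 * _]mulrC divfK // mulrC.
Qed.

Lemma valuesP x : values a x <-> exists2 u, u \in V & x = a ord0 * j u.
Proof.
split=> [[c ->] | [u Vu ->]].
  exists (\sum_i c i *: v`_i); last exact: qf_ratios.
  by apply: memv_suml => i _; rewrite memvZ // memv_span // mem_nth ?size_tuple.
exists (fun i => coord v i u); rewrite qf_ratios; congr (_ * j _).
exact: coord_span Vu.
Qed.

(** The image [j E] is one of the subfields intersected in [norm_field]: it contains the squares,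
    and a product of two values is [a_0 ^ 2 * j (y * z) = j (a_0 *: (y * z))]. *)
Lemma norm_field_sub (E : {subfield M}) x : (V <= E)%VS ->
  norm_field a x -> exists2 y, y \in E & x = j y.
Proof.
move=> sVE /(_ (fun x => exists2 y, y \in E & x = j y)); apply; first split.
- by exists 0; rewrite ?mem0v ?rmorph0.
- by exists 1; rewrite ?mem1v ?rmorph1.
- by move=> _ _ [y Ey ->] [z Ez ->]; exists (y - z); rewrite ?rpredB ?rmorphB.
- by move=> _ _ [y Ey ->] [z Ez ->]; exists (y * z); rewrite ?memvM ?rmorphM.
- by move=> _ [y Ey ->]; exists y^-1; rewrite ?memvV ?fmorphV.
- by move=> _ [c ->]; exists c%:A; rewrite ?memvZ ?mem1v.
move=> _ _ /valuesP[y Vy ->] /valuesP[z Vz ->].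
exists ((a ord0) *: (y * z)); first by rewrite memvZ // memvM // (subvP sVE).
by rewrite jZ rmorphM mulrACA -expr2.
Qed.

(** A relation over [F] among preimages under [j] becomes a relation with square coefficients, so
    independence over the squares lifts to [M]. *)
Lemma ext_degree_leq_dim k (U : {vspace M}) (L : F -> Prop) :
    ext_degree_eq (@squares F) L k ->
    (forall x, L x -> exists2 y, y \in U & x = j y) -> (k <= \dim U)%N.
Proof.
move=> [e [Le [indep _]]] LU.
have /fin_all_exists[y yP] i : exists y, y \in U /\ e i = j y.
  by have [y Uy ->] := LU _ (Le i); exists y.
have /eqP dim_y : free (codom y).
  apply/free_codomP=> c sum0 i; apply/eqP; rewrite -sqrf_eq0; apply/eqP.
  apply: (indep (fun i => c i ^+ 2)) => [l|]; first by exists (c l).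
  rewrite -[RHS](rmorph0 j) -sum0 rmorph_sum; apply: eq_bigr => l _.
  by rewrite jZ; case: (yP l) => _ ->.
rewrite size_codom card_ord in dim_y; rewrite -dim_y; apply/dimvS/span_subvP.
by move=> _ /codomP[i ->]; case: (yP i).
Qed.

Section Structure.
Variables (Q : {subfield M}) (x y z : M).
Hypothesis defV : V = (Q + Q * <[x]> + Q * <[y]> + Q * <[z]>)%VS.

Let E := [aspace of <<<<<<Q; x>>; y>>; z>>%VS].

Let sQxV g : (Q * <[g]> <= V)%VS -> g \in V.
Proof. by move/subvP; apply; rewrite -{1}[g]mul1r memv_mul ?mem1v ?memv_line. Qed.

Let Vx : x \in V.
Proof. by apply: sQxV; rewrite defV; do 2!apply: subv_trans (addvSl _ _); apply: addvSr. Qed.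
Let Vy : y \in V.
Proof. by apply: sQxV; rewrite defV; apply: subv_trans (addvSl _ _); apply: addvSr. Qed.
Let Vz : z \in V.
Proof. by apply: sQxV; rewrite defV addvSr. Qed.
Let sQV : (Q <= V)%VS.
Proof. by rewrite defV -!addvA addvSl. Qed.

Let sVE : (V <= E)%VS.
Proof.
have sQE : (Q <= E)%VS.
  by do 2!apply: (subv_trans _ (subv_adjoin _ _)); apply: subv_adjoin.
have Qg g : g \in E -> (Q * <[g]> <= E)%VS by move=> Eg; rewrite prodv_sub // -memvE.
rewrite defV !subv_add sQE !Qg //.
- exact: memv_adjoin.
- by apply: subvP_adjoin; apply: memv_adjoin.
by do 2!apply: subvP_adjoin; apply: memv_adjoin.
Qed.

Let norm_fieldE u : u \in E -> norm_field a (j u).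
Proof.
move=> Eu S [S0 S1 SB SM SI] Ssq Sprod.
have SD c e : S c -> S e -> S (c + e).
  by move=> Sc Se; rewrite -[e]opprK -[- e]sub0r; apply: (SB) => //; apply: (SB).
have SV w : w \in V -> S (j w).
  (* As [1] lies in [V], [a_0] is a value, so [j w] is a product of two values divided by
     [a_0 ^ 2]. *)
  move=> Vw; have -> : j w = a ord0 * j w * (a ord0 * j 1) * (a ord0)^-1 ^+ 2.
    by rewrite rmorph1; field.
  apply: SM; last by apply: Ssq; exists (a ord0)^-1.
  apply: Sprod; apply/valuesP; first by exists w.
  by exists 1 => //; apply: span_ratios1.
have Sadj (K : {subfield M}) g : (forall q, q \in K -> S (j q)) -> g \in V ->
    forall q, q \in <<K; g>>%VS -> S (j q).
  move=> SK Vg q /(Fadjoin_sqrP sqr1)[p Kp [p' Kp' ->]].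
  by rewrite rmorphD rmorphM; apply: SD; [apply: SK | apply: SM; [apply: SK | apply: SV]].
apply: (Sadj [aspace of <<<<Q; x>>; y>>%VS] z) Eu => //.
apply: (Sadj [aspace of <<Q; x>>%VS] y) => //.
apply: (Sadj Q x) => // q Qq; apply: SV; exact: subvP sQV q Qq.
Qed.

(** The norm field is [j E], and [j] carries a basis of [E] over [F] to one of the norm field over
    the squares. *)
Lemma structure_lndeg k :
  \dim <<<<<<Q; x>>; y>>; z>> = (2 ^ k)%N -> lndeg_eq a k.
Proof.
move=> dimE; pose X := tcast dimE (vbasis E).
have basisX : basis_of E X by rewrite /X val_tcast vbasisP.
exists (fun i => j X`_i); split; [|split].
- by move=> i; apply: norm_fieldE; rewrite (basis_mem basisX) // mem_nth ?size_tuple.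
- move=> c c_sqr sum0 i.
  have /fin_all_exists[e def_c] l : exists e, c l = e ^+ 2 := c_sqr l; rewrite def_c.
  have /freeP freeX := basis_free basisX.
  rewrite (freeX e) ?expr0n //; apply: (fmorph_inj j); rewrite rmorph0 -[RHS]sum0.
  by rewrite rmorph_sum; apply: eq_bigr => l _; rewrite jZ def_c.
move=> u /(norm_field_sub sVE)[w Ew ->].
exists (fun i => coord X i w ^+ 2); split=> [i|]; first by exists (coord X i w).
rewrite {1}(coord_basis basisX Ew) rmorph_sum.
by apply: eq_bigr => i _; rewrite jZ.
Qed.

(** Products of square-root generators of [Q] with [1, x, y, z] form a basis of [V]. On it the form
    is the tensor product of the quasi-Pfister form with slots [j (be i)] and
    [a_0 <1, j x, j y, j z>]. *)
Lemma structure_divisible s :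
  \dim Q = (2 ^ s)%N -> r.+1 = (4 * 2 ^ s)%N -> divisible_by_qpfister a s.
Proof.
move=> dimQ def_r; have [bs defQ] := subfield_generators sqr1 dimQ.
pose be i := tnth bs i; pose g i := tnth [tuple 1; x; y; z] i.
have codom_tnth n (T : eqType) (t : n.-tuple T) : codom (tnth t) = t.
  by rewrite codomE map_tnth_enum.
have spanQ := adjoin_products sqr1 be; rewrite codom_tnth defQ in spanQ.
pose w (p : {set 'I_s} * 'I_4) := \prod_(i in p.1) be i * g p.2.
have basisV : basis_of V (codom w).
  rewrite basisEdim size_codom card_prod card_ord dim_span_ratios def_r mulnC.
  rewrite -cardsT -powersetT card_powerset cardsT card_ord leqnn andbT.
  have Qg i : (Q * <[g i]> <= span (codom w))%VS.
    apply/prodvP=> q _ Qq /vlineP[k ->]; rewrite -scalerAr memvZ //.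
    move: Qq; rewrite spanQ => /mem_span_codom[c ->].
    rewrite mulr_suml memv_suml // => T _; rewrite -scalerAl memvZ //.
    by apply/memv_span/codomP; exists (T, i).
  have := (Qg (inord 0), Qg (inord 1), Qg (inord 2), Qg (inord 3)).
  rewrite /g !(tnth_nth 0) !inordK //= prodv1 => [[[[Q0 Q1] Q2] Q3]].
  by rewrite defV !subv_add Q0 Q1 Q2 Q3.
exists (fun i => j (be i)), 4%N, (fun i => a ord0 * j (g i)).
apply: (isometric_bases (v := tnth v) (w := w) (e := a ord0) jA).
- by rewrite codom_tnth.
- exact: basis_free basisV.
- by rewrite codom_tnth (span_basis basisV).
- by move=> i; rewrite (tnth_nth 0) jv mulrC divfK.
by move=> p; rewrite /qtensor /qpfister /w rmorphM rmorph_prod mulrCA.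
Qed.

End Structure.

(** The isometry turns the tensor basis into a basis of [V] made of monomials in the [be i] times
    elements [g i], where [sigma i = a_0 * j (g i)] is a value of the form. The field generated by
    the [be i] therefore acts on [V]. *)
Lemma divisible_module s (b be : 'I_s -> _) e (sigma : 'I_e -> F) :
    (forall i, j (be i) = b i) -> isometric a (qtensor (qpfister b) sigma) ->
  exists S : {subfield M}, (S * V <= V)%VS /\ \dim S = (2 ^ s)%N.
Proof.
move=> jbe [A [B [BA [AB qfA]]]]; set tau := qtensor _ _ in qfA.
have AB_apply (t : {set 'I_s} * 'I_e -> F) p :
    \sum_i A p i * (\sum_p' B i p' * t p') = t p.
  under eq_bigr do rewrite mulr_sumr; rewrite exchange_big /=.
  rewrite (bigD1 p) //= [X in _ + X]big1 ?addr0 => [|p' p'p]; last first.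
    under eq_bigr do rewrite mulrA; rewrite -mulr_suml AB eq_sym.
    by rewrite (negPf p'p) mul0r.
  by under eq_bigr do rewrite mulrA; rewrite -mulr_suml AB eqxx mul1r.
have qfB t : qf a (fun i => \sum_p B i p * t p) = qf tau t.
  by rewrite -qfA; apply: eq_bigr => p _; rewrite AB_apply.
have tau_val p : exists2 u, u \in V & tau p = a ord0 * j u.
  apply/valuesP; exists (fun i => \sum_p' B i p' * (p' == p)%:R).
  rewrite (qfB (fun p' => (p' == p)%:R)) /qf (bigD1 p) //= eqxx expr1n mulr1.
  by rewrite big1 ?addr0 // => p' /negPf->; rewrite expr0n mulr0.
have /fin_all_exists[g jg] i : exists g, sigma i = a ord0 * j g.
  have [g _] := tau_val (set0, i); rewrite /tau /qtensor /qpfister big_set0 mul1r.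
  by exists g.
pose w (p : {set 'I_s} * 'I_e) := \prod_(i in p.1) be i * g p.2.
have tauE p : tau p = a ord0 * j (w p).
  rewrite /tau /qtensor /qpfister /w rmorphM rmorph_prod jg mulrCA.
  by congr (_ * (_ * _)); apply: eq_bigr => i _; rewrite jbe.
have Vw p : w p \in V.
  have [u Vu] := tau_val p; rewrite tauE => /(mulfI a0)/(fmorph_inj j)-> //.
have qf_tau t : qf tau t = a ord0 * j (\sum_p t p *: w p).
  rewrite rmorph_sum mulr_sumr; apply: eq_bigr => p _.
  by rewrite tauE jZ -mulrA [j (w p) * _]mulrC.
have free_w c : \sum_p c p *: w p = 0 -> forall p, c p = 0.
  move=> sum0 p; have : qf tau c = 0 by rewrite qf_tau sum0 rmorph0 mulr0.
  rewrite -qfB => /an_a Bc0.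
  by rewrite -(AB_apply c p); apply: big1 => i _; rewrite Bc0 mulr0.
have span_w u : u \in V -> exists c, u = \sum_p c p *: w p.
  move=> Vu; exists (fun p => \sum_i A p i * coord v i u).
  apply: (fmorph_inj j); apply: (mulfI a0); rewrite -qf_tau qfA qf_ratios.
  by rewrite -(coord_span Vu).
pose S := [aspace of <<1 & codom be>>%VS].
have defS : S = span (codom (fun T : {set 'I_s} => \prod_(i in T) be i)) :> {vspace M}.
  exact: adjoin_products.
(* The second tensor factor is nonempty because [V] contains [1]; translating by one [g i0] shows
   that the monomials are independent. *)
have [i0 _] : exists i0 : 'I_e, True.
  case: (pickP 'I_e) => [i0 _ | no_i]; first by exists i0.
  have [c] := span_w 1 span_ratios1; rewrite big1 => [/eqP|[T i]]; last by have := no_i i.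
  by rewrite oner_eq0.
exists S; split.
  apply/prodvP=> q u Sq /span_w[c ->]; rewrite mulr_sumr memv_suml // => p _.
  rewrite -scalerAr memvZ // /w mulrA.
  have : q * \prod_(i in p.1) be i \in S.
    apply: memvM => //; apply: rpred_prod => i _.
    by apply/seqv_sub_adjoin/codom_f.
  rewrite defS => /mem_span_codom[k ->]; rewrite mulr_suml memv_suml // => T _.
  by rewrite -scalerAl memvZ //; apply: (Vw (T, p.2)).
have cardT : #|{set 'I_s}| = (2 ^ s)%N.
  by rewrite -cardsT -powersetT card_powerset cardsT card_ord.
have free_prod : free (codom (fun T : {set 'I_s} => \prod_(i in T) be i)).
  apply/free_codomP=> c sum0 T.
  have := free_w (fun p => if p.2 == i0 then c p.1 else 0) _ (T, i0).
  rewrite eqxx; apply; rewrite -[RHS](mul0r (g i0)) -[X in _ = X * _]sum0 mulr_suml.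
  transitivity (\sum_T' \sum_k (if k == i0 then c T' else 0) *: w (T', k)).
    by rewrite pair_bigA; apply: eq_bigr => [[]].
  apply: eq_bigr => T' _; rewrite (bigD1 i0) //= eqxx -scalerAl [X in _ + X]big1 ?addr0 // => k /negPf->.
  exact: scale0r.
by move: free_prod; rewrite /free -defS size_codom cardT => /eqP.
Qed.

End NormField.

(** * The two implications *)

Section QuarterIndex.
Variables (F : fieldType) (r s : nat) (a : 'I_r.+1 -> F).
Hypotheses (F2 : 2%N \in [pchar F]) (an_a : anisotropic a).
Hypothesis def_r : r.+1 = (4 * 2 ^ s)%N.

Let r_gt0 : (0 < r)%N.
Proof.
rewrite -ltnS def_r (@leq_trans (4 * 1)) // leq_mul2l /=.
exact: expn_gt0.
Qed.

Let Finf := anisotropic_poly_eval F2 r_gt0 an_a.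

Let ratios (M : fieldExtType F) (j : {rmorphism M -> F}) :
    (forall i, exists y, j y = a i / a ord0) ->
  exists v : r.+1.-tuple M, forall i : 'I_r.+1, j v`_i = a i / a ord0.
Proof.
move/fin_all_exists=> [y jy]; exists [tuple y i | i < r.+1] => i.
by rewrite -tnth_nth tnth_mktuple.
Qed.

Lemma quarter_i1_structure :
  i1_eq a (2 ^ s) -> lndeg_eq a s.+3 /\ divisible_by_qpfister a s.
Proof.
have [M [j [jA j_surj]]] := Frobenius_extension F2 (codom (fun i => a i / a ord0)).
have [|v jv] := @ratios M j; first by move=> i; apply/j_surj/codomP; exists i.
move/(i1_eq_idealizer F2 Finf an_a r_gt0 jA jv) => [min_dim [b Vb dim_b]].
have dimV := etrans (dim_span_ratios an_a jA jv) def_r.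
have V1 := span_ratios1 an_a jv.
have sqr1 := Frobenius_sqr1 jA.
have gb : good (span v) s b by rewrite /good Vb dim_b eqxx.
have [Q [x [y [z [dimQ defV dimE]]]]] :=
  half_idealizer_structure sqr1 Finf V1 dimV min_dim gb.
split; last exact (structure_divisible an_a jA jv defV dimQ def_r).
by apply: (structure_lndeg an_a jA jv defV); rewrite dimE !expnS !mulnA.
Qed.

(** If [V] were a field, its image under [j] would contain the norm field, whose degree [8 * 2 ^ s]
    exceeds [dim V = 4 * 2 ^ s]. *)
Lemma structure_quarter_i1 :
  lndeg_eq a s.+3 -> divisible_by_qpfister a s -> i1_eq a (2 ^ s).
Proof.
move=> lndeg [b [e [sigma iso]]].
(* The slots of the quasi-Pfister form need preimages in [M] too, to generate the subfield [S]. *)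
have [M [j [jA j_surj]]] :=
  Frobenius_extension F2 (codom (fun i => a i / a ord0) ++ codom b).
have [|v jv] := @ratios M j.
  by move=> i; apply: j_surj; rewrite mem_cat; apply/orP; left; apply/codomP; exists i.
have /fin_all_exists[be jbe] i : exists y, j y = b i.
  by apply: j_surj; rewrite mem_cat codom_f orbT.
have [S [SV dimS]] := divisible_module an_a jA jv jbe iso.
have sqr1 := Frobenius_sqr1 jA; have V1 := span_ratios1 an_a jv.
have dimV : \dim (span v) = (4 * \dim S)%N.
  by rewrite (dim_span_ratios an_a jA jv) def_r dimS.
apply/(i1_eq_idealizer F2 Finf an_a r_gt0 jA jv); rewrite -dimS; split.
  exact: module_idealizer_ge.
apply: module_idealizer_eq => // E defE.
have := ext_degree_leq_dim jA lndeg (U := E) _; rewrite {2}defE dimV dimS.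
have normE x : norm_field a x -> exists2 y, y \in E & x = j y.
  by apply: (norm_field_sub an_a jA jv); rewrite defE.
move/(_ normE); rewrite !expnS !mulnA leq_pmul2r ?expn_gt0 //.
Qed.

End QuarterIndex.

Theorem theorem5p4 (F : fieldType) (n : nat) (a : 'I_(2 ^ n) -> F) :
  (2%N \in [pchar F]) -> (2 <= n)%N -> anisotropic a ->
  i1_eq a (2 ^ (n - 2)) <->
  (lndeg_eq a n.+1 /\ divisible_by_qpfister a (n - 2)).
Proof.
move=> F2; case: n a => [|[|s]] // a _; rewrite !subSS subn0.
have [r def_r] : exists r, (2 ^ s.+2 = r.+1)%N.
  by exists (2 ^ s.+2).-1; rewrite prednK ?expn_gt0.
have def_r4 : r.+1 = (4 * 2 ^ s)%N by rewrite -def_r !expnS mulnA.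
move: a; rewrite def_r => a an_a; split; first exact: quarter_i1_structure.
by case; apply: structure_quarter_i1.
Qed.
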